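(* Let $0<\ell\le1$, $T>0$, $u_0\in L^2(0,\ell)$, $u_0\neq0$, and let $\alpha_1,\alpha_2\in[0,2)$. For $i=1,2$ let $u_i$ be the solution of the degenerate problem with power $\alpha_i$ (described in the context). If for some $t_0\in(0,T]$ we have $\partial_t u_1(x,t_0)=\partial_t u_2(x,t_0)$ and $\partial_x u_1(x,t_0)=\partial_x u_2(x,t_0)$ for all $x\in(0,\ell)$, then $\alpha_1=\alpha_2$.
   Context: For $\alpha\in[0,2)$, the degenerate problem with power $\alpha$ is $\partial_t u-\partial_x(x^\alpha\partial_x u)=0$ in $(0,\ell)\times(0,T)$, $u(x,0)=u_0(x)$, with boundary conditions $u(0,t)=u(\ell,t)=0$ if $0\le\alpha<1$ (weak degeneracy), and $x^\alpha\partial_x u(x,t)|_{x=0}=0$, $u(\ell,t)=0$ if $1\le\alpha<2$ (strong degeneracy). Its solution is $u(t)=e^{tA}u_0$, where $Au=\partial_x(x^\alpha\partial_xu)$ with domain $\{u\in H^1_\alpha(0,\ell): x^\alpha\partial_x u\in H^1(0,\ell)\}$ generates an analytic contraction semigroup on $L^2(0,\ell)$; here $H^1_\alpha(0,\ell)=\{u\in L^2:\int_0^\ell x^\alpha|\partial_xu|^2<\infty,\ u(0)=u(\ell)=0\}$ for $\alpha<1$ and $\{u\in L^2:\int_0^\ell x^\alpha|\partial_xu|^2<\infty,\ u(\ell)=0\}$ for $1\le\alpha<2$. *)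

(* Defs.v *)
From HB Require Import structures.
From mathcomp Require Import all_boot all_order all_algebra.
From mathcomp Require Import all_classical all_reals all_analysis.
Set Implicit Arguments. Unset Strict Implicit. Unset Printing Implicit Defensive.
Import Order.TTheory GRing.Theory Num.Theory.
Import numFieldNormedType.Exports.
Local Open Scope classical_set_scope.
Local Open Scope ring_scope.

Section Defs.
Variable R : realType.
Local Notation mu := (@lebesgue_measure R).

Definition Iol (l : R) : set R := `]0, l[.

Definition isL2 (l : R) (f : R -> R) : Prop :=
  measurable_fun (Iol l) f /\
  (\int[mu]_(x in Iol l) ((f x) ^+ 2)%:E < +oo)%E.

Definition L2dist2 (l : R) (f g : R -> R) : \bar R :=
  \int[mu]_(x in Iol l) ((f x - g x) ^+ 2)%:E.

Definition ae_eq_on (l : R) (f g : R -> R) : Prop :=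
  {ae mu, forall x, Iol l x -> f x = g x}.

Definition test_fun (l : R) (phi : R -> R) : Prop :=
  (forall (n : nat) (x : R), derivable (derive1n n phi) x 1) /\
  exists a b : R, [/\ 0 < a, a < b, b < l &
    forall x, ~ `[a, b]%classic x -> phi x = 0].

Definition L1loc (l : R) (g : R -> R) : Prop :=
  measurable_fun (Iol l) g /\
  forall a b : R, 0 < a -> a < b -> b < l -> mu.-integrable `[a, b]%classic (EFin \o g).

Definition weak_deriv (l : R) (f g : R -> R) : Prop :=
  L1loc l f /\ L1loc l g /\
  forall phi, test_fun l phi ->
    Rintegral mu (Iol l) (fun x => f x * derive1 phi x) =
    - Rintegral mu (Iol l) (fun x => g x * phi x).

(* H^1_alpha(0,l) with the boundary conditions of the context:
   u(0)=u(l)=0 if alpha < 1, u(l)=0 if 1 <= alpha < 2; boundary values are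
   those of the continuous representative of u on (0,l). *)
Definition H1_alpha (l alpha : R) (u : R -> R) : Prop :=
  isL2 l u /\
  (exists g, weak_deriv l u g /\
     (\int[mu]_(x in Iol l) ((x `^ alpha) * (g x) ^+ 2)%:E < +oo)%E) /\
  exists uc : R -> R,
    [/\ {in Iol l, continuous uc}, ae_eq_on l u uc,
        uc x @[x --> l^'-] --> 0 &
        alpha < 1 -> uc x @[x --> 0^'+] --> 0].

Definition isH1 (l : R) (v : R -> R) : Prop :=
  isL2 l v /\ exists g, weak_deriv l v g /\ isL2 l g.

(* graph of the operator A u = (x^alpha u_x)_x with domain
   { u in H^1_alpha : x^alpha u_x in H^1 } *)
Definition A_op (l alpha : R) (u w : R -> R) : Prop :=
  H1_alpha l alpha u /\
  exists g, [/\ weak_deriv l u g,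
               isH1 l (fun x => x `^ alpha * g x),
               weak_deriv l (fun x => x `^ alpha * g x) w & isL2 l w].

(* v is the L^2(0,l)-valued derivative of t |-> u t at t (t in (0,T]),
   taken within (0,T] (one-sided at t = T) *)
Definition time_deriv (l T : R) (u : R -> R -> R) (t : R) (v : R -> R) : Prop :=
  isL2 l v /\
  forall e : R, 0 < e -> exists2 d : R, 0 < d & forall h : R,
    h != 0 -> `|h| < d -> 0 < t + h -> t + h <= T ->
    (L2dist2 l (fun x => ((u (t + h) x - u t x) / h)%R) v < e%:E)%E.

(* u (u t x = u(x,t)) is the solution u(t) = e^{tA} u0 on (0,T]:
   the (unique) strong solution of u' = A u in L^2(0,l), u(t) -> u0 as t -> 0+ *)
Definition is_solution (l T alpha : R) (u0 : R -> R) (u : R -> R -> R) : Prop :=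
  (forall t, 0 < t -> t <= T ->
     exists w, A_op l alpha (u t) w /\ time_deriv l T u t w) /\
  (forall e : R, 0 < e -> exists2 d : R, 0 < d & forall t : R,
     0 < t -> t < d -> t <= T -> (L2dist2 l (u t) u0 < e%:E)%E).

End Defs.

(* Main.v *)
Require Import Defs.
From mathcomp Require Import all_boot all_order all_algebra.
From mathcomp Require Import all_classical all_reals all_analysis.
From mathcomp Require Import measurable_realfun.
From mathcomp Require Import ring lra.
Import Order.TTheory GRing.Theory Num.Theory.
Import numFieldNormedType.Exports.
Set Implicit Arguments.
Unset Strict Implicit.
Unset Printing Implicit Defensive.
Local Open Scope classical_set_scope.
Local Open Scope ring_scope.

(* Write [U] for the continuous representative of [u1 t0] and [g] for its derivative, which is
   also that of [u2 t0]. The fluxes [x^a1 g] and [x^a2 g] have the same derivative, so they differ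
   by a constant: [(x^a1 - x^a2) g = c]. If [a1 < a2] then [x^a1 > x^a2] on [(0, l)], so [c U] is
   nondecreasing. It vanishes at [l], and at [0] when [a1 < 1]; when [a1 >= 1], [c = 0] because
   [x^a1 g^2 >= c^2 / x] is integrable. Hence [U = 0], that is, [u1 t0 = 0].

   This forces [u0 = 0] by backward uniqueness. The boundary terms of the Wronskian of two domain
   elements vanish, so the operator is symmetric, and [<u(t), u(c - t)>] does not depend on [t].
   Hence [|u((r + s) / 2)|^2 = <u(r), u(s)>], and [u(t) = 0] implies [u(3/4 t) = 0]; iterate
   and let [t] tend to [0].

   Weak derivatives are turned into integrals by du Bois-Reymond's lemma. *)

Section integrable_real.
Context d (T : measurableType d) (R : realType).
Variables (mu : {measure set T -> \bar R}) (D : set T).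
Hypothesis mD : measurable D.
Implicit Types (f g : T -> R).

Lemma integrable_measurable f : mu.-integrable D (EFin \o f) -> measurable_fun D f.
Proof. by move=> /(measurable_int mu)/measurable_EFinP. Qed.

Lemma integrable_EFinD f g : mu.-integrable D (EFin \o f) ->
  mu.-integrable D (EFin \o g) -> mu.-integrable D (EFin \o (f \+ g)).
Proof. exact: integrableD. Qed.

Lemma integrable_EFinB f g : mu.-integrable D (EFin \o f) ->
  mu.-integrable D (EFin \o g) -> mu.-integrable D (EFin \o (f \- g)).
Proof. exact: integrableB. Qed.

Lemma integrable_EFinZ f (c : R) : mu.-integrable D (EFin \o f) ->
  mu.-integrable D (EFin \o (fun x => c * f x)).
Proof. exact: integrableZl. Qed.

Lemma integrable_le f g : measurable_fun D f ->
  (forall x, D x -> `|f x| <= g x) -> mu.-integrable D (EFin \o g) ->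
  mu.-integrable D (EFin \o f).
Proof.
move=> mf fg; apply: le_integrable => //; first exact/measurable_EFinP.
by move=> x Dx /=; rewrite lee_fin (le_trans (fg _ Dx))// ler_norm.
Qed.

Lemma integrable_EFin_cst (c : R) : (mu D < +oo)%E -> mu.-integrable D (EFin \o cst c).
Proof.
move=> Doo; apply: measurable_bounded_integrable => //.
by exists `|c|; split; rewrite ?num_real// => M /ltW cM x _.
Qed.

Lemma integrable_ge0P f : measurable_fun D f -> (forall x, D x -> 0 <= f x) ->
  mu.-integrable D (EFin \o f) <-> (\int[mu]_(x in D) (f x)%:E < +oo)%E.
Proof.
move=> mf f0; have normE : (\int[mu]_(x in D) `|(EFin \o f) x| =
    \int[mu]_(x in D) (f x)%:E)%E.
  by apply: eq_integral => x /set_mem Dx /=; rewrite ger0_norm// f0.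
split; first by move=> /integrableP[_]; rewrite normE.
by move=> foo; apply/integrableP; split; [exact/measurable_EFinP|rewrite normE].
Qed.

Lemma eq_Rintegral_ae f g : measurable_fun D f -> measurable_fun D g ->
  {ae mu, forall x, D x -> f x = g x} -> \int[mu]_(x in D) f x = \int[mu]_(x in D) g x.
Proof.
move=> mf mg fg; congr fine; apply: ae_eq_integral => //; [exact/measurable_EFinP..|].
by apply: filterS fg => x fg Dx; rewrite fg.
Qed.

Lemma eq_integrable_ae f g : measurable_fun D g -> {ae mu, forall x, D x -> f x = g x} ->
  mu.-integrable D (EFin \o f) -> mu.-integrable D (EFin \o g).
Proof.
move=> mg fg fi; have mf := integrable_measurable fi.
case/integrableP: fi => _ foo; apply/integrableP; split; first exact/measurable_EFinP.
rewrite (ge0_ae_eq_integral (g := fun x => `|(EFin \o f) x|%E))//.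
- by apply: measurableT_comp => //; exact/measurable_EFinP.
- by apply: measurableT_comp => //; exact/measurable_EFinP.
- by apply: filterS fg => x fg Dx /=; rewrite fg.
Qed.

Lemma Rintegral_subset_ge0 (A : set T) f : measurable A -> A `<=` D ->
  mu.-integrable D (EFin \o f) -> (forall x, D x -> 0 <= f x) ->
  \int[mu]_(x in A) f x <= \int[mu]_(x in D) f x.
Proof.
move=> mA AD fi f0; apply: fine_le.
- by apply: integrable_fin_num => //; apply: integrableS fi.
- exact: integrable_fin_num.
- by apply: ge0_subset_integral => //; apply/measurable_EFinP; exact: integrable_measurable.
Qed.

Lemma Rintegral_dominated_cvg (fs : nat -> T -> R) f g :
  (forall n, measurable_fun D (fs n)) -> measurable_fun D f ->
  (forall x, D x -> fs n x @[n --> \oo] --> f x) ->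
  mu.-integrable D (EFin \o g) -> (forall n x, D x -> `|fs n x| <= g x) ->
  \int[mu]_(x in D) fs n x @[n --> \oo] --> \int[mu]_(x in D) f x.
Proof.
move=> mfs mf fs_f gi fs_g.
have [||||| fi _ cvg_int] := @dominated_convergence _ _ _ mu _ mD
  (fun n => EFin \o fs n) (EFin \o f) (EFin \o g) => //.
- by move=> n; apply/measurable_EFinP; exact: mfs.
- exact/measurable_EFinP.
- by apply: nearW => x Dx; apply: cvg_EFin; [exact: nearW|exact: fs_f].
- by apply: nearW => x n Dx; rewrite lee_fin fs_g.
by apply: fine_cvg; rewrite fineK//; exact: integrable_fin_num.
Qed.

Lemma integrable_patch f : mu.-integrable D (EFin \o f) ->
  mu.-integrable setT (EFin \o (f \_ D)).
Proof. by move=> fi; rewrite -restrict_EFin; apply/integrable_restrict => //; rewrite setTI. Qed.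

Lemma ae_subr_eq0 f g : {ae mu, forall x, D x -> f x - g x = 0} ->
  {ae mu, forall x, D x -> f x = g x}.
Proof. by apply: filterS => x /[apply] /eqP; rewrite subr_eq0 => /eqP. Qed.

Lemma Rintegral_supported (A : set T) f : A `<=` D ->
  (forall x, D x -> ~ A x -> f x = 0) ->
  \int[mu]_(x in D) f x = \int[mu]_(x in A) f x.
Proof.
move=> AD f0; rewrite -[in RHS](setIidr AD) Rintegral_mkcondr.
apply: eq_Rintegral => x /set_mem Dx; rewrite patchE.
by case: ifPn => // /negP nA; apply: f0 => // Ax; apply: nA; exact: mem_set.
Qed.

End integrable_real.

Section square_integrable.
Context d (T : measurableType d) (R : realType).
Variables (mu : {measure set T -> \bar R}) (D : set T).
Hypothesis mD : measurable D.
Implicit Types (f g h : T -> R).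

Definition sqr_integrable f :=
  measurable_fun D f /\ (\int[mu]_(x in D) (f x ^+ 2)%:E < +oo)%E.

Definition dotL2 f g : R := \int[mu]_(x in D) (f x * g x).

Definition sqnormL2 f : R := \int[mu]_(x in D) (f x ^+ 2).

Lemma sqr_integrableP f : sqr_integrable f <->
  measurable_fun D f /\ mu.-integrable D (EFin \o (fun x => f x ^+ 2)).
Proof.
have sqr0 x : D x -> 0 <= f x ^+ 2 by move=> _; exact: sqr_ge0.
by split=> -[mf fi]; split=> //; apply/integrable_ge0P => //; exact: measurable_funX.
Qed.

Lemma sqr_integrable_mul f g : sqr_integrable f -> sqr_integrable g ->
  mu.-integrable D (EFin \o (fun x => f x * g x)).
Proof.
move=> /sqr_integrableP[mf f2] /sqr_integrableP[mg g2].
apply: (@integrable_le _ _ _ mu D _ _ (fun x => f x ^+ 2 + g x ^+ 2)) => //.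
- exact: measurable_funM.
- by move=> x _; rewrite ler_norml; apply/andP; split; nra.
- exact: integrable_EFinD.
Qed.

Lemma sqr_integrableD f g : sqr_integrable f -> sqr_integrable g -> sqr_integrable (f \+ g).
Proof.
move=> fL gL; have fg := sqr_integrable_mul fL gL.
case/sqr_integrableP: fL => mf f2; case/sqr_integrableP: gL => mg g2.
apply/sqr_integrableP; split; first exact: measurable_funD.
have := integrable_EFinD mD f2 (integrable_EFinD mD (integrable_EFinZ mD 2 fg) g2).
by apply: eq_integrable => // x _ /=; congr EFin; ring.
Qed.

Lemma sqr_integrableZ f (c : R) : sqr_integrable f -> sqr_integrable (fun x => c * f x).
Proof.
move=> /sqr_integrableP[mf f2]; apply/sqr_integrableP; split; first exact: measurable_funM.
apply: eq_integrable (integrable_EFinZ mD (c ^+ 2) f2) => //.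
by move=> x _ /=; rewrite exprMn.
Qed.

Lemma sqr_integrableB f g : sqr_integrable f -> sqr_integrable g -> sqr_integrable (f \- g).
Proof.
move=> fL gL; have := sqr_integrableD fL (sqr_integrableZ (-1) gL).
by congr sqr_integrable; apply/funext => x /=; rewrite mulN1r.
Qed.

Lemma sqr_integrable_cst (c : R) : (mu D < +oo)%E -> sqr_integrable (cst c).
Proof.
move=> Doo; apply/sqr_integrableP; split=> //.
exact: (integrable_EFin_cst mD (c ^+ 2) Doo).
Qed.

Lemma sqr_integrable_integrable f : (mu D < +oo)%E -> sqr_integrable f ->
  mu.-integrable D (EFin \o f).
Proof.
move=> Doo fL; have := sqr_integrable_mul fL (sqr_integrable_cst 1 Doo).
by apply: eq_integrable => // x _ /=; rewrite mulr1.
Qed.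

Lemma sqr_integrable_ae f g : measurable_fun D g -> {ae mu, forall x, D x -> f x = g x} ->
  sqr_integrable f -> sqr_integrable g.
Proof.
move=> mg fg /sqr_integrableP[_ f2]; apply/sqr_integrableP; split=> //.
apply: eq_integrable_ae f2 => //; first exact: measurable_funX.
by apply: filterS fg => x fg Dx; rewrite fg.
Qed.

Lemma dotL2C f g : dotL2 f g = dotL2 g f.
Proof. by apply: eq_Rintegral => x _; rewrite mulrC. Qed.

Lemma dotL2Dl f g h : sqr_integrable f -> sqr_integrable g -> sqr_integrable h ->
  dotL2 (f \+ g) h = dotL2 f h + dotL2 g h.
Proof.
move=> fL gL hL; rewrite /dotL2 -RintegralD//; [|exact: sqr_integrable_mul..].
by apply: eq_Rintegral => x _; rewrite mulrDl.
Qed.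

Lemma dotL2Zl f g (c : R) : sqr_integrable f -> sqr_integrable g ->
  dotL2 (fun x => c * f x) g = c * dotL2 f g.
Proof.
move=> fL gL; rewrite /dotL2 -RintegralZl//; last exact: sqr_integrable_mul.
by apply: eq_Rintegral => x _; rewrite mulrA.
Qed.

Lemma dotL2Bl f g h : sqr_integrable f -> sqr_integrable g -> sqr_integrable h ->
  dotL2 (f \- g) h = dotL2 f h - dotL2 g h.
Proof.
move=> fL gL hL; rewrite /dotL2 -RintegralB//; [|exact: sqr_integrable_mul..].
by apply: eq_Rintegral => x _; rewrite mulrBl.
Qed.

Lemma dotL2_sqnorm f : dotL2 f f = sqnormL2 f.
Proof. by apply: eq_Rintegral => x _; rewrite expr2. Qed.

Lemma sqnormL2_ge0 f : 0 <= sqnormL2 f.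
Proof. by apply: Rintegral_ge0 => x _; exact: sqr_ge0. Qed.

Lemma sqnormL2Z f (c : R) : sqr_integrable f ->
  sqnormL2 (fun x => c * f x) = c ^+ 2 * sqnormL2 f.
Proof.
move=> /sqr_integrableP[_ f2]; rewrite /sqnormL2 -RintegralZl//.
by apply: eq_Rintegral => x _; rewrite exprMn.
Qed.

Lemma sqnormL2D f g : sqr_integrable f -> sqr_integrable g ->
  sqnormL2 (f \+ g) = sqnormL2 f + 2 * dotL2 f g + sqnormL2 g.
Proof.
move=> fL gL; have fgL := sqr_integrableD fL gL.
by rewrite -!dotL2_sqnorm dotL2Dl// !(dotL2C _ (f \+ g)) !dotL2Dl// (dotL2C g f); ring.
Qed.

Lemma dotL2_sqr_le f g : sqr_integrable f -> sqr_integrable g ->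
  dotL2 f g ^+ 2 <= sqnormL2 f * sqnormL2 g.
Proof.
move=> fL gL; pose p := Poly [:: sqnormL2 g; 2 * dotL2 f g; sqnormL2 f].
suff : p`_1 ^+ 2 - 4 * p`_2 * p`_0 <= 0 by rewrite !coefE/=; lra.
rewrite deg_le2_poly_ge0 ?size_Poly// => c.
have := sqnormL2_ge0 ((fun x => c * f x) \+ g).
rewrite sqnormL2D//; last exact: sqr_integrableZ.
rewrite sqnormL2Z// dotL2Zl//; congr (_ <= _).
by rewrite horner_Poly/=; ring.
Qed.

Lemma normr_dotL2_le f g : sqr_integrable f -> sqr_integrable g ->
  `|dotL2 f g| <= Num.sqrt (sqnormL2 f) * Num.sqrt (sqnormL2 g).
Proof.
move=> fL gL; rewrite -sqrtrM ?sqnormL2_ge0// -sqrtr_sqr.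
by rewrite ler_wsqrtr// dotL2_sqr_le.
Qed.

Lemma sqnormL2_eq0 f : sqr_integrable f -> sqnormL2 f = 0 ->
  {ae mu, forall x, D x -> f x = 0}.
Proof.
move=> /sqr_integrableP[mf f2] f0.
have sqr_ae0 : ae_eq mu D (fun x => (f x ^+ 2)%:E) (cst 0%E).
  apply/ae_eq_integral_abs => //; first by apply/measurable_EFinP; exact: measurable_funX.
  under eq_integral do rewrite gee0_abs ?lee_fin ?sqr_ge0//.
  by rewrite -[LHS]fineK ?[fine _]f0//; exact: integrable_fin_num.
by apply: filterS sqr_ae0 => x /[apply] -[] /eqP; rewrite sqrf_eq0 => /eqP.
Qed.

Lemma sqnormL2_ae0 f : measurable_fun D f -> {ae mu, forall x, D x -> f x = 0} -> sqnormL2 f = 0.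
Proof.
move=> mf f0; rewrite /sqnormL2 (@eq_Rintegral_ae _ _ _ mu _ _ _ (cst 0))//.
- by rewrite Rintegral_cst// mul0r.
- exact: measurable_funX.
- by apply: filterS f0 => x f0 Dx; rewrite f0// expr0n.
Qed.

Section convergence.
Context {I : Type} {F : set_system I} {FF : Filter F}.
Implicit Types (fs gs : I -> T -> R).

Definition cvgL2 fs f := (\forall i \near F, sqr_integrable (fs i)) /\
  sqnormL2 (fs i \- f) @[i --> F] --> 0.

Lemma cvgL2_cst f : sqr_integrable f -> cvgL2 (fun=> f) f.
Proof.
move=> fL; split; first exact: nearW.
rewrite (_ : f \- f = (fun x => 0 * f x)); last first.
  by apply/funext => x /=; rewrite subrr mul0r.
by rewrite sqnormL2Z// expr0n mul0r; exact: cvg_cst.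
Qed.

Lemma cvgL2_dotL2_0 fs gs (c : R) : (\forall i \near F, sqr_integrable (fs i)) ->
  (\forall i \near F, sqr_integrable (gs i)) ->
  sqnormL2 (fs i) @[i --> F] --> 0 -> sqnormL2 (gs i) @[i --> F] --> c ->
  dotL2 (fs i) (gs i) @[i --> F] --> 0.
Proof.
move=> fL gL f0 gc; apply: norm_cvg0.
have bound0 : Num.sqrt (sqnormL2 (fs i)) * Num.sqrt (sqnormL2 (gs i)) @[i --> F] --> 0.
  rewrite (_ : 0 = Num.sqrt 0 * Num.sqrt c); last by rewrite sqrtr0 mul0r.
  by apply: cvgM; (apply: continuous_cvg; first exact: sqrt_continuous).
apply: squeeze_cvgr bound0; last exact: cvg_cst.
by near=> i; rewrite normr_ge0/= normr_dotL2_le//; near: i.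
Unshelve. all: by end_near. Qed.

Lemma cvgL2_dotL2 fs gs f g : sqr_integrable f -> sqr_integrable g ->
  cvgL2 fs f -> cvgL2 gs g -> dotL2 (fs i) (gs i) @[i --> F] --> dotL2 f g.
Proof.
move=> fL gL [fsL fs_f] [gsL gs_g].
have fBL : \forall i \near F, sqr_integrable (fs i \- f).
  by apply: filterS fsL => i ?; exact: sqr_integrableB.
have gBL : \forall i \near F, sqr_integrable (gs i \- g).
  by apply: filterS gsL => i ?; exact: sqr_integrableB.
have sum0 : dotL2 (fs i \- f) (gs i \- g) + dotL2 (fs i \- f) g +
    dotL2 (gs i \- g) f + dotL2 f g @[i --> F] --> 0 + 0 + 0 + dotL2 f g.
  have cst_cvg (h : T -> R) : sqnormL2 h @[_ --> F] --> sqnormL2 h by exact: cvg_cst.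
  apply: cvgD; last exact: cvg_cst.
  apply: cvgD; [apply: cvgD|].
  - exact: (cvgL2_dotL2_0 fBL gBL fs_f gs_g).
  - by apply: (cvgL2_dotL2_0 (gs := fun=> g) fBL _ fs_f (cst_cvg g)); exact: nearW.
  - by apply: (cvgL2_dotL2_0 (gs := fun=> f) gBL _ gs_g (cst_cvg f)); exact: nearW.
rewrite !add0r in sum0; apply: cvg_trans sum0; apply: near_eq_cvg.
near=> i.
have fiL : sqr_integrable (fs i) by near: i.
have giL : sqr_integrable (gs i) by near: i.
have gBiL := sqr_integrableB giL gL.
by rewrite !dotL2Bl// ![dotL2 _ (gs i \- g)]dotL2C !dotL2Bl// !(dotL2C g) !(dotL2C (gs i)); ring.
Unshelve. all: by end_near. Qed.

Lemma cvgL2_sqnormL2 fs f : sqr_integrable f -> cvgL2 fs f ->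
  sqnormL2 (fs i) @[i --> F] --> sqnormL2 f.
Proof.
move=> fL fs_f; under eq_fun do rewrite -dotL2_sqnorm.
by rewrite -dotL2_sqnorm; exact: cvgL2_dotL2.
Qed.

End convergence.

Lemma cvgL2_unique {I : Type} {F : set_system I} {FF : ProperFilter F}
    (fs : I -> T -> R) f g : sqr_integrable f -> sqr_integrable g ->
  cvgL2 (F := F) fs f -> cvgL2 (F := F) fs g -> {ae mu, forall x, D x -> f x = g x}.
Proof.
move=> fL gL fs_f fs_g; have fgL := sqr_integrableB fL gL.
have dot_eq h : sqr_integrable h -> dotL2 f h = dotL2 g h.
  move=> hL; have h_h := @cvgL2_cst I F FF h hL.
  exact: (norm_cvg_unique (cvgL2_dotL2 fL hL fs_f h_h) (cvgL2_dotL2 gL hL fs_g h_h)).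
have : sqnormL2 (f \- g) = 0 by rewrite -dotL2_sqnorm dotL2Bl// dot_eq// subrr.
by move=> /sqnormL2_eq0-/(_ fgL); exact: ae_subr_eq0.
Qed.

End square_integrable.

Lemma sqr_integrableS d (T : measurableType d) (R : realType) (mu : {measure set T -> \bar R})
    (A D : set T) (f : T -> R) : measurable A -> measurable D -> A `<=` D ->
  sqr_integrable mu D f -> sqr_integrable mu A f.
Proof.
move=> mA mD AD /sqr_integrableP[mf f2]; apply/sqr_integrableP; split.
  exact: measurable_funS mf.
exact: integrableS f2.
Qed.

Section fubini_real.
Context d1 d2 (T1 : measurableType d1) (T2 : measurableType d2) (R : realType).
Variables (m1 : {sigma_finite_measure set T1 -> \bar R}).
Variables (m2 : {sigma_finite_measure set T2 -> \bar R}).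

Lemma Rintegral_Fubini (h : T1 * T2 -> R) : (m1 \x m2)%E.-integrable setT (EFin \o h) ->
  (forall x, m2.-integrable setT (EFin \o (fun y => h (x, y)))) ->
  (forall y, m1.-integrable setT (EFin \o (fun x => h (x, y)))) ->
  \int[m1]_x (\int[m2]_y h (x, y)) = \int[m2]_y (\int[m1]_x h (x, y)).
Proof.
move=> hi h1 h2; rewrite /Rintegral; congr fine.
under eq_integral => x _ do rewrite fineK ?(integrable_fin_num measurableT (h1 x))//.
under [RHS]eq_integral => y _ do rewrite fineK ?(integrable_fin_num measurableT (h2 y))//.
exact: Fubini hi.
Qed.

Lemma integrable_prodM (f : T1 -> R) (g : T2 -> R) :
  m1.-integrable setT (EFin \o f) -> m2.-integrable setT (EFin \o g) ->
  (m1 \x m2)%E.-integrable setT (fun z => (f z.1 * g z.2)%:E).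
Proof.
move=> fi gi; have mf := integrable_measurable fi; have mg := integrable_measurable gi.
apply/integrable12ltyP.
  by apply/measurable_EFinP; apply: measurable_funM; exact: measurableT_comp.
have [/integrableP[_ foo] /integrableP[_ goo]] := (fi, gi).
under eq_integral => x _.
  under eq_integral => y _ do rewrite /= normrM EFinM.
  rewrite ge0_integralZl//; last exact/measurable_EFinP/measurableT_comp.
  over.
rewrite /= ge0_integralZr//.
- by apply: lte_mul_pinfty => //; [exact: integral_ge0|rewrite ge0_fin_numE//; exact: integral_ge0].
- by apply/measurable_EFinP; exact: measurableT_comp.
- exact: integral_ge0.
Qed.

End fubini_real.

Section interval_integrals.
Context {R : realType}.
Local Notation mu := (@lebesgue_measure R).
Implicit Types (f g : R -> R) (a b x y : R).

Lemma integrable_subitv a b x y f : a <= x -> y <= b ->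
  mu.-integrable `[a, b] (EFin \o f) -> mu.-integrable `[x, y] (EFin \o f).
Proof.
move=> ax yb; apply: integrableS => //.
by apply: subset_itv; rewrite bnd_simp.
Qed.

Lemma Rintegral_itvD a b c f : a <= c -> c <= b ->
  mu.-integrable `[a, b] (EFin \o f) ->
  \int[mu]_(x in `[a, b]) f x = \int[mu]_(x in `[a, c]) f x + \int[mu]_(x in `[c, b]) f x.
Proof.
move=> ac cb fi; have := @Rintegral_itvB _ f (BLeft a) (BRight b) c fi.
rewrite !bnd_simp => /(_ ac cb) fB.
rewrite -(@Rintegral_itv_obnd_cbnd _ c (BRight b)) -?fB; first by rewrite addrC subrK.
apply: integrableS fi => //.
by apply: subset_itv; rewrite bnd_simp.
Qed.

Lemma Rintegral_Fubini_le f g : mu.-integrable setT (EFin \o f) ->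
  mu.-integrable setT (EFin \o g) ->
  \int[mu]_x (f x * \int[mu]_(y in `]-oo, x]) g y) =
  \int[mu]_y ((\int[mu]_(x in `[y, +oo[) f x) * g y).
Proof.
move=> fi gi; have [mf mg] := (integrable_measurable fi, integrable_measurable gi).
pose h (z : R * R) := if z.2 <= z.1 then f z.1 * g z.2 else 0.
have rowE x : (fun y => h (x, y)) = (fun y => f x * (g \_ `]-oo, x]) y).
  apply/funext => y; rewrite /h/= patchE mem_setE in_itv/=.
  by case: ifP => // _; rewrite mulr0.
have colE y : (fun x => h (x, y)) = (fun x => (f \_ `[y, +oo[) x * g y).
  apply/funext => x; rewrite /h/= patchE mem_setE in_itv/= andbT.
  by case: ifP => // _; rewrite mul0r.
have patchi k (i : interval R) : mu.-integrable setT (EFin \o k) ->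
    mu.-integrable setT (EFin \o (k \_ [set` i])).
  by move=> ki; apply: integrable_patch => //; apply: integrableS ki.
have [gxi fyi] := (fun x => patchi _ `]-oo, x] gi, fun y => patchi _ `[y, +oo[ fi).
have hi : (mu \x mu)%E.-integrable setT (EFin \o h).
  apply: le_integrable (integrable_prodM fi gi) => //.
    apply/measurable_EFinP; apply: measurable_fun_ifT => //; first exact: measurable_fun_ler.
    by apply: measurable_funM; exact: measurableT_comp.
  by move=> z _; rewrite lee_fin /h; case: ifP => // _; rewrite normr0.
transitivity (\int[mu]_x \int[mu]_y h (x, y)).
  by apply: eq_Rintegral => x _; rewrite rowE RintegralZl// -Rintegral_mkcond.
rewrite Rintegral_Fubini//; last 2 first.
- by move=> x; rewrite rowE; exact: integrable_EFinZ.
- move=> y; rewrite colE; under eq_fun do rewrite mulrC; exact: integrable_EFinZ.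
by apply: eq_Rintegral => y _; rewrite colE RintegralZr// -Rintegral_mkcond.
Qed.

Lemma Rintegral_triangle a b f g :
  mu.-integrable `[a, b] (EFin \o f) -> mu.-integrable `[a, b] (EFin \o g) ->
  \int[mu]_(x in `[a, b]) (f x * \int[mu]_(y in `[a, x]) g y) =
  \int[mu]_(y in `[a, b]) ((\int[mu]_(x in `[y, b]) f x) * g y).
Proof.
move=> fi gi; have swap :
    \int[mu]_x ((f \_ `[a, b]) x * \int[mu]_(y in `]-oo, x]) (g \_ `[a, b]) y) =
    \int[mu]_y ((\int[mu]_(x in `[y, +oo[) (f \_ `[a, b]) x) * (g \_ `[a, b]) y).
  by apply: Rintegral_Fubini_le; exact: integrable_patch.
rewrite [LHS]Rintegral_mkcond [RHS]Rintegral_mkcond.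
transitivity (\int[mu]_x ((f \_ `[a, b]) x * \int[mu]_(y in `]-oo, x]) (g \_ `[a, b]) y)).
  apply: eq_Rintegral => x _; rewrite !patchE; case: ifPn => [|_]; last by rewrite mul0r.
  rewrite inE/= in_itv/= => /andP[_ xb]; rewrite -Rintegral_mkcondr; congr (_ * Rintegral _ _ _).
  apply/seteqP; split=> y /=; rewrite !in_itv/=; last by case=> -> /andP[->].
  by move=> /andP[-> yx]; rewrite yx (le_trans yx).
rewrite swap; apply: eq_Rintegral => y _; rewrite !patchE.
case: ifPn => [|_]; last by rewrite mulr0.
rewrite inE/= in_itv/= => /andP[ay _]; rewrite -Rintegral_mkcondr; congr (Rintegral _ _ _ * _).
apply/seteqP; split=> x /=; rewrite !in_itv/= ?andbT; first by case=> -> /andP[_ ->].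
by move=> /andP[yx ->]; rewrite yx (le_trans ay yx).
Qed.

End interval_integrals.

(* Filter inference does not see this instance through the measurable structure of
   [lebesgue_measure]. *)
#[local] Instance ae_lebesgue_filter (R : realType) :
  Filter (nbhs (almost_everywhere (@lebesgue_measure R))) :=
  ae_filter_ringOfSetsType (@lebesgue_measure R).

Lemma measurable_Iol (R : realType) (l : R) : measurable (Iol l : set (measurableTypeR R)).
Proof. exact: measurable_itv. Qed.
#[local] Hint Extern 0 (measurable _) => solve [exact: measurable_Iol] : core.

Section primitives.
Context {R : realType}.
Local Notation mu := (@lebesgue_measure R).
Implicit Types (f g h F G : R -> R) (l : R).

Definition primitive_on l F f := L1loc l f /\
  forall x y : R, 0 < x -> x <= y -> y < l -> F y - F x = \int[mu]_(t in `[x, y]) f t.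

Lemma IolP l (x : R) : Iol l x <-> 0 < x /\ x < l.
Proof. by rewrite /Iol/= in_itv/=; split=> [/andP[]|[-> ->]]. Qed.

Lemma subset_itv_Iol l (x y : R) : 0 < x -> y < l -> `[x, y] `<=` Iol l.
Proof.
move=> x0 yl t /=; rewrite in_itv/= => /andP[xt ty]; apply/IolP.
by split; [exact: lt_le_trans xt|exact: le_lt_trans yl].
Qed.

Lemma nbhs_right0_Iol l : 0 < l -> \forall x \near 0^'+, Iol l x.
Proof.
by move=> l0; near=> x; apply/IolP; split; near: x; [exact: nbhs_right_gt|exact: nbhs_right_lt].
Unshelve. all: by end_near. Qed.

Lemma nbhs_left_Iol l : 0 < l -> \forall x \near l^'-, Iol l x.
Proof.
by move=> l0; near=> x; apply/IolP; split; near: x; [exact: nbhs_left_gt|exact: nbhs_left_lt].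
Unshelve. all: by end_near. Qed.

Lemma open_Iol l : open (Iol l).
Proof. exact: interval_open. Qed.

Lemma L1loc_integrable l f (x y : R) : L1loc l f -> 0 < x -> y < l ->
  mu.-integrable `[x, y] (EFin \o f).
Proof.
move=> [mf fi] x0 yl; have [xy|yx|xy] := ltgtP x y; first exact: fi.
- by rewrite set_itv_ge ?bnd_simp -?ltNge//; exact: integrable_set0.
- apply: (@integrable_subitv _ (y / 2) y) => //; first by rewrite xy; lra.
  by apply: fi => //; lra.
Qed.

Lemma integrable_L1loc l f : mu.-integrable (Iol l) (EFin \o f) -> L1loc l f.
Proof.
move=> fi; split; first exact: (integrable_measurable fi).
by move=> x y x0 xy yl; apply: integrableS fi => //; exact: subset_itv_Iol.
Qed.

Lemma L1locD l f g : L1loc l f -> L1loc l g -> L1loc l (f \+ g).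
Proof.
move=> [mf fi] [mg gi]; split; first exact: measurable_funD.
by move=> a b a0 ab bl; apply: integrable_EFinD => //; [exact: fi|exact: gi].
Qed.

Lemma L1locB l f g : L1loc l f -> L1loc l g -> L1loc l (f \- g).
Proof.
move=> [mf fi] [mg gi]; split; first exact: measurable_funB.
by move=> a b a0 ab bl; apply: integrable_EFinB => //; [exact: fi|exact: gi].
Qed.

Lemma continuous_measurable_Iol l h : {in Iol l, continuous h} -> measurable_fun (Iol l) h.
Proof. by move=> ch; apply: open_continuous_measurable_fun => //; exact: open_Iol. Qed.

Lemma continuous_mul_L1loc l h f : {in Iol l, continuous h} -> L1loc l f ->
  L1loc l (fun x => h x * f x).
Proof.
move=> ch [mf fi]; have mh := continuous_measurable_Iol ch.
split=> [|a b a0 ab bl]; first exact: measurable_funM.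
have abI := subset_itv_Iol a0 bl.
have chab : {within `[a, b], continuous h}.
  by apply: continuous_in_subspaceT => x /set_mem /abI/mem_set; exact: ch.
apply: (integrableMr _ _ _ (fi a b a0 ab bl)) => //.
  exact: measurable_funS mh.
have /compact_bounded[M [_ hM]] := continuous_compact chab (@segment_compact _ a b).
by exists M; split; rewrite ?num_real// => N MN x xab; apply: (hM N MN); exists x.
Qed.

Lemma continuous_L1loc l h : {in Iol l, continuous h} -> L1loc l h.
Proof.
move=> ch; split=> [|a b a0 ab bl]; first exact: continuous_measurable_Iol.
apply: continuous_compact_integrable; first exact: segment_compact.
by apply: continuous_in_subspaceT => x /set_mem /(subset_itv_Iol a0 bl)/mem_set; exact: ch.
Qed.

Lemma cst_L1loc l (c : R) : L1loc l (cst c).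
Proof. by apply: continuous_L1loc => x _; exact: cvg_cst. Qed.

Lemma primitive_continuous l F f : primitive_on l F f -> {in Iol l, continuous F}.
Proof.
move=> [fi Ff] x; rewrite inE => /IolP[x0 xl].
pose a := x / 2; pose b := (x + l) / 2.
have [a0 bl ax xb] : [/\ 0 < a, b < l, a < x & x < b] by rewrite /a /b; split; lra.
have iab := L1loc_integrable fi a0 bl.
have /(continuous_within_itvP _ (lt_trans ax xb))[cint _ _] :=
  parameterized_integral_continuous (ltW (lt_trans ax xb)) iab.
have {}cint : F a + \int[mu]_(t in `[a, y]) f t @[y --> x] -->
    F a + \int[mu]_(t in `[a, x]) f t.
  by apply: cvgD; [exact: cvg_cst|apply: cint; rewrite in_itv/= ax].
rewrite /continuous_at -[F x](subrK (F a)) addrC (Ff _ _ a0 (ltW ax) xl).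
apply: cvg_trans cint; apply: near_eq_cvg; near=> y.
have yl : y < l by near: y; exact: lt_nbhsl.
have ay : a <= y by apply/ltW; near: y; exact: lt_nbhsr.
by rewrite -(Ff _ _ a0 ay yl) addrC subrK.
Unshelve. all: by end_near. Qed.

Lemma primitiveB l F G f g : primitive_on l F f -> primitive_on l G g ->
  primitive_on l (F \- G) (f \- g).
Proof.
move=> [fi Ff] [gi Gg]; split; first exact: L1locB.
move=> x y x0 xy yl.
rewrite RintegralB//; [|exact: (L1loc_integrable fi)|exact: (L1loc_integrable gi)].
by rewrite -Ff// -Gg//=; ring.
Qed.

Lemma eq_ae_primitive l F f g : primitive_on l F f -> L1loc l g -> ae_eq_on l f g ->
  primitive_on l F g.
Proof.
move=> [fi Ff] gi fg; split => // x y x0 xy yl; rewrite Ff//.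
have xyI := subset_itv_Iol x0 yl.
apply: eq_Rintegral_ae => //.
- by apply: measurable_funS xyI _ => //; case: fi.
- by apply: measurable_funS xyI _ => //; case: gi.
- by apply: filterS fg => t fg /xyI; exact: fg.
Qed.

(* Integration by parts, from Fubini's theorem on a triangle. *)
Lemma primitiveM l F G f g : primitive_on l F f -> primitive_on l G g ->
  primitive_on l (F \* G) (fun x => F x * g x + G x * f x).
Proof.
move=> FF GG; have [fl Ff] := FF; have [gl Gg] := GG.
have Fgl := continuous_mul_L1loc (primitive_continuous FF) gl.
have Gfl := continuous_mul_L1loc (primitive_continuous GG) fl.
split=> [|a b a0 ab bl]; first exact: L1locD.
have [fi gi] := (L1loc_integrable fl a0 bl, L1loc_integrable gl a0 bl).
have [Fgi Gfi] := (L1loc_integrable Fgl a0 bl, L1loc_integrable Gfl a0 bl).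
have := Rintegral_triangle gi fi.
have -> : \int[mu]_(x in `[a, b]) (g x * \int[mu]_(y in `[a, x]) f y) =
    \int[mu]_(x in `[a, b]) (F x * g x) - F a * (G b - G a).
  rewrite (Gg a b)// -RintegralZl// -RintegralB//; last exact: integrable_EFinZ.
  apply: eq_Rintegral => x; rewrite inE/= in_itv/= => /andP[ax xb].
  by rewrite -Ff//; [ring|exact: le_lt_trans bl].
have -> : \int[mu]_(y in `[a, b]) ((\int[mu]_(x in `[y, b]) g x) * f y) =
    G b * (F b - F a) - \int[mu]_(y in `[a, b]) (G y * f y).
  rewrite (Ff a b)// -RintegralZl// -RintegralB//; last exact: integrable_EFinZ.
  apply: eq_Rintegral => x; rewrite inE/= in_itv/= => /andP[ax xb].
  by rewrite -Gg//; [ring|exact: lt_le_trans ax].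
by rewrite RintegralD//= => ?; lra.
Qed.

Lemma primitive_exists l f : 0 < l -> L1loc l f -> exists F, primitive_on l F f.
Proof.
move=> l0 fl; pose m := l / 2; have [m0 ml] : 0 < m /\ m < l by rewrite /m; split; lra.
exists (fun x => if m <= x then \int[mu]_(t in `[m, x]) f t
                 else - \int[mu]_(t in `[x, m]) f t).
split=> // x y x0 xy yl.
have fxm : mu.-integrable `[x, m] (EFin \o f) by exact: (L1loc_integrable fl).
have fmy : mu.-integrable `[m, y] (EFin \o f) by exact: (L1loc_integrable fl).
have fxy : mu.-integrable `[x, y] (EFin \o f) by exact: (L1loc_integrable fl).
have [mx|/ltW xm] := leP m x.
  by rewrite (le_trans mx xy) (Rintegral_itvD mx xy fmy); ring.
have [my|/ltW ym] := leP m y.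
  by rewrite (Rintegral_itvD xm my fxy); ring.
by rewrite (Rintegral_itvD xy ym fxm); ring.
Qed.

Lemma primitive_eq_on l F G f : (forall x, Iol l x -> F x = G x) ->
  primitive_on l F f -> primitive_on l G f.
Proof.
move=> FG [fi Ff]; split => // x y x0 xy yl.
by rewrite -Ff// !FG//; apply/IolP; split => //; [exact: le_lt_trans yl|exact: lt_le_trans xy].
Qed.

Lemma primitive_cst_diff l F G f : primitive_on l F f -> primitive_on l G f ->
  exists c, forall x, Iol l x -> F x = G x + c.
Proof.
move=> [_ Ff] [_ Gf]; exists (F (l / 2) - G (l / 2)) => x /IolP[x0 xl].
have [xm|/ltW mx] := leP x (l / 2).
  by have := Gf x (l / 2) x0 xm; rewrite -Ff//; lra.
by have := Gf (l / 2) x; rewrite -Ff//; lra.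
Qed.

Lemma C1_primitive l F f : (forall x : R, is_derive x 1 F (f x)) -> continuous f ->
  primitive_on l F f.
Proof.
move=> dF cf; split=> [|x y x0 xy yl].
  split=> [|a b a0 ab bl].
    by apply: measurable_funTS; exact: continuous_measurable_fun.
  apply: continuous_compact_integrable; first exact: segment_compact.
  exact: continuous_subspaceT.
have cF : continuous F.
  by move=> t; apply/differentiable_continuous/derivable1_diffP; case: (dF t).
have [xlty|ylex] := ltP x y; last first.
  by rewrite (le_anti (introT andP (conj xy ylex))) set_itv1 Rintegral_set1 subrr.
rewrite /Rintegral (@continuous_FTC2 _ _ F)//.
- exact: continuous_subspaceT.
- split; [by move=> t _; case: (dF t)|exact/cvg_at_right_filter/cF|].
  exact/cvg_at_left_filter/cF.
- by move=> t _; rewrite derive1E; case: (dF t).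
Qed.

Lemma primitive_cvg_ends l F f : 0 < l -> primitive_on l F f ->
  mu.-integrable (Iol l) (EFin \o f) -> exists2 c, F x @[x --> 0^'+] --> c &
    F x @[x --> l^'-] --> c + \int[mu]_(x in Iol l) f x.
Proof.
move=> l0 Ff fi; pose k := f \_ (Iol l).
have kl : mu.-integrable `[0, l] (EFin \o k).
  by apply: (@integrableS _ _ _ mu setT) => //; exact: integrable_patch.
pose K (x : R) := \int[mu]_(t in `[0, x]) k t.
have Kf : primitive_on l K f.
  split=> [|x y x0 xy yl]; first exact: integrable_L1loc.
  rewrite /K (@Rintegral_itvD _ 0 y x) ?(ltW x0)//; last first.
    by apply: integrable_subitv kl => //; exact: ltW.
  rewrite addrAC subrr add0r; apply: eq_Rintegral => t /set_mem /(subset_itv_Iol x0 yl) tI.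
  by rewrite /k patchE mem_set.
have [c FK] := primitive_cst_diff Ff Kf.
have Kl : K l = \int[mu]_(x in Iol l) f x.
  by rewrite /K -Rintegral_mkcondr setIidr//; apply: subset_itv; rewrite bnd_simp.
have FKc (H : set_system R) : Filter H -> (\forall x \near H, Iol l x) ->
    forall L, K x @[x --> H] --> L -> F x @[x --> H] --> c + L.
  move=> HF HI L KL; rewrite addrC.
  apply: (cvg_trans _ (cvgD KL (cvg_cst c))); apply: near_eq_cvg.
  by apply: filterS HI => x xI; rewrite FK.
exists c.
  rewrite -[c]addr0; apply: FKc; first exact: nbhs_right0_Iol.
  apply: cvg_at_right_filter; exact: parameterized_integral_cvg_left kl.
apply: FKc; first exact: nbhs_left_Iol.
rewrite -Kl; exact: parameterized_integral_cvg_at_left kl.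
Qed.

End primitives.

Section smooth_functions.
Context {R : realType}.
Implicit Types (f g : R -> R) (a b x : R).

Fixpoint nderivable (n : nat) f : Prop :=
  if n is m.+1 then (forall x, derivable f x 1) /\ nderivable m (derive1 f) else True.

Definition smooth f := forall n, nderivable n f.

Lemma nderivableW n f : nderivable n.+1 f -> nderivable n f.
Proof.
by elim: n f => //= n IH f [df [df' sf]]; split => //; apply: IH.
Qed.

Lemma smoothP f : smooth f <-> forall n x, derivable (derive1n n f) x 1.
Proof.
split=> [sf n|df n].
  elim: n f {sf}(sf n.+1) => [f []//|n IH f [_ sf'] x].
  by rewrite derive1Sn; exact: IH.
elim: n f df => //= n IH f df; split; first exact: (df 0%N).
by apply: IH => k x; rewrite -derive1Sn; exact: df.
Qed.

Lemma nderivable_cst n (c : R) : nderivable n (cst c).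
Proof.
elim: n c => //= n IH c; split => [x|]; first exact: derivable_cst.
by rewrite (_ : derive1 (cst c) = cst 0)//; apply/funext => x; rewrite derive1_cst.
Qed.

Lemma nderivable_id n : nderivable n (@id R).
Proof.
case: n => //= n; split => [x|]; first exact: derivable_id.
rewrite (_ : derive1 id = cst 1); first exact: nderivable_cst.
by apply/funext => x; rewrite derive1_id.
Qed.

Lemma nderivableD n f g : nderivable n f -> nderivable n g -> nderivable n (f + g).
Proof.
elim: n f g => //= n IH f g [df sf] [dg sg]; split=> [x|]; first exact: derivableD.
rewrite (_ : derive1 (f + g) = derive1 f + derive1 g); first exact: IH.
by apply/funext => x; rewrite derive1E deriveD// -!derive1E.
Qed.

Lemma nderivableM n f g : nderivable n f -> nderivable n g -> nderivable n (f * g).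
Proof.
elim: n f g => //= n IH f g [df sf] [dg sg]; split=> [x|]; first exact: derivableM.
rewrite (_ : derive1 (f * g) = f * derive1 g + g * derive1 f).
  by apply: nderivableD; apply: IH => //; exact: nderivableW.
by apply/funext => x; rewrite derive1E deriveM// -!derive1E.
Qed.

Lemma nderivable_comp n f g : nderivable n f -> nderivable n g -> nderivable n (f \o g).
Proof.
elim: n f g => //= n IH f g [df sf] [dg sg].
have dfg x : is_derive x 1 (f \o g) (derive1 f (g x) * derive1 g x).
  by apply: is_derive1_comp; rewrite derive1E; exact/derivableP.
split=> [x|]; first by case: (dfg x).
rewrite (_ : derive1 (f \o g) = (derive1 f \o g) * derive1 g).
  by apply: nderivableM => //; apply: IH => //; exact: nderivableW.
by apply/funext => x; rewrite derive1E; case: (dfg x).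
Qed.

(* The exponent [n] makes the family closed under differentiation. *)
Definition flat (n : nat) (x : R) : R :=
  if 0 < x then x^-1 ^+ n * expR (- x^-1) else 0.

Lemma flat_le0 n x : x <= 0 -> flat n x = 0.
Proof. by move=> x0; rewrite /flat ltNge x0. Qed.

Lemma norm_flat_le n x : `|flat n x| <= n.+2`!%:R * x ^+ 2.
Proof.
rewrite /flat; case: ifPn => x0; last by rewrite normr0 mulr_ge0// sqr_ge0.
have y0 : 0 < x^-1 by rewrite invr_gt0.
rewrite ger0_norm; last by rewrite mulr_ge0 ?expR_ge0// exprn_ge0// ltW.
rewrite -[x in leRHS]invrK; move: (x^-1) y0 => y y0.
have /(le_trans _) expy := expR_ge1Dxn n.+1 (ltW y0).
have f0 : (0 : R) < n.+2`!%:R by rewrite ltr0n fact_gt0.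
rewrite expRN ler_pdivrMr ?expR_gt0// exprVn mulrAC ler_pdivlMr ?exprn_gt0//.
rewrite -exprD addn2 mulrC -ler_pdivrMr//; apply: expy; lra.
Qed.

Lemma is_derive_flat_gt0 n x : 0 < x ->
  is_derive x 1 (flat n) (flat n.+2 x - n%:R * flat n.+1 x).
Proof.
move=> x0; apply: (@near_eq_is_derive _ _ _ (fun y : R => y^-1 ^+ n * expR (- y^-1))).
  by near=> y; rewrite /flat ifT//; near: y; apply: lt_nbhsr.
have dV : is_derive x 1 (fun y : R => y^-1) (- x^-1 ^+ 2).
  have := @is_deriveV _ id x 1 1 (lt0r_neq0 x0) (is_derive_id _ _).
  by rewrite /GRing.scale/= mulr1 exprVn.
have dexp : is_derive x 1 (fun y : R => expR (- y^-1)) (x^-1 ^+ 2 * expR (- x^-1)).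
  have := @is_derive1_comp _ expR (fun y => - y^-1) _ _ _ (is_derive_expR _) (is_deriveN dV).
  by rewrite opprK mulrC.
rewrite (_ : (fun y : R => _) =
    (fun y : R => y^-1) ^+ n * (fun y : R => expR (- y^-1))); last first.
  by apply/funext => y; rewrite !fctE.
have dM := is_deriveM (is_deriveX n dV) dexp.
apply: (is_derive_eq dM); rewrite /flat x0 !fctE /GRing.scale/=.
by case: n {dM} => [|n] /=; rewrite !exprS; ring.
Unshelve. all: by end_near. Qed.

Lemma is_derive_flat0 n : is_derive (0 : R) 1 (flat n) 0.
Proof.
suff : h^-1 *: (flat n (h *: 1 + 0) - flat n 0) @[h --> (0:R)^'] --> (0:R).
  by move=> d0; apply: DeriveDef; [apply/cvg_ex; exists 0|exact/cvg_lim].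
apply/cvgrPdist_le => e e0; near=> h.
rewrite sub0r normrN addr0 [flat n 0]flat_le0// subr0 /GRing.scale/= mulr1.
have h0 : h != 0 by near: h; exact: nbhs_dnbhs_neq.
rewrite normrM normfV mulrC ler_pdivrMr ?normr_gt0//.
apply: le_trans (norm_flat_le _ _) _.
rewrite -real_normK ?num_real// expr2 mulrA ler_wpM2r//.
have f0 : (0 : R) < n.+2`!%:R by rewrite ltr0n fact_gt0.
rewrite mulrC -ler_pdivlMr//; near: h.
by apply: dnbhs0_le; rewrite divr_gt0.
Unshelve. all: by end_near. Qed.

Lemma is_derive_flat n x : is_derive x 1 (flat n) (flat n.+2 x - n%:R * flat n.+1 x).
Proof.
have [x0|x0|->] := ltgtP x 0; last 2 first.
- exact: is_derive_flat_gt0.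
- rewrite !flat_le0// mulr0 subr0; exact: is_derive_flat0.
rewrite !flat_le0 ?(ltW x0)// mulr0 subr0.
apply: (@near_eq_is_derive _ _ _ (cst 0)).
by near=> y; rewrite flat_le0// ltW//; near: y; apply: lt_nbhsl.
Unshelve. all: by end_near. Qed.

Lemma smooth_flat n : smooth (flat n).
Proof.
move=> k; elim: k n => //= k IH n; split => [x|]; first by case: (is_derive_flat n x).
rewrite (_ : derive1 _ = flat n.+2 + cst (- n%:R) * flat n.+1).
  by apply: nderivableD => //; apply: nderivableM => //; exact: nderivable_cst.
apply/funext => x; rewrite derive1E; case: (is_derive_flat n x) => _ ->.
by rewrite !fctE mulNr.
Qed.

Lemma flat0_ge0 x : 0 <= flat 0 x.
Proof. by rewrite /flat; case: ifP => // _; rewrite expr0 mul1r expR_ge0. Qed.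

Lemma flat0_le1 x : flat 0 x <= 1.
Proof.
rewrite /flat; case: ifP => // x0.
by rewrite expr0 mul1r -expR0 ler_expR oppr_le0 invr_ge0 ltW.
Qed.

Lemma cvg_flat0_mulrn x : 0 < x -> flat 0 (n.+1%:R * x) @[n --> \oo] --> (1 : R).
Proof.
move=> x0.
have -> : (fun n => flat 0 (n.+1%:R * x)) = (fun n => expR (- (x^-1 * harmonic n))).
  by apply/funext => n; rewrite /flat mulr_gt0// expr0 mul1r invfM mulrC.
have : - (x^-1 * harmonic n) @[n --> \oo] --> - (x^-1 * 0 : R).
  by apply: cvgN; apply: cvgM; [exact: cvg_cst|exact: cvg_harmonic].
rewrite mulr0 oppr0 -[X in _ --> X]expR0 => /cvg_comp; apply; exact: continuous_expR.
Qed.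

Definition bump a b (n : nat) (x : R) : R := flat 0 (n.+1%:R * ((x - a) * (b - x))).

Lemma smooth_bump a b n : smooth (bump a b n).
Proof.
move=> k; rewrite (_ : bump a b n =
    flat 0 \o (cst n.+1%:R * ((id + cst (- a)) * (cst b + cst (-1) * id)))); last first.
  by apply/funext => x; rewrite /bump !fctE/= mulN1r.
have cst_k (c : R) := nderivable_cst k c; have id_k := nderivable_id k.
apply: nderivable_comp; first exact: smooth_flat.
do 2 apply: nderivableM => //; apply: nderivableD => //; exact: nderivableM.
Qed.

Lemma bump_ge0 a b n x : 0 <= bump a b n x.
Proof. exact: flat0_ge0. Qed.

Lemma bump_le1 a b n x : bump a b n x <= 1.
Proof. exact: flat0_le1. Qed.

Lemma bump_out a b n x : a <= b -> ~~ (a < x < b) -> bump a b n x = 0.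
Proof.
move=> ab; rewrite negb_and -!leNgt => xab; apply: flat_le0.
rewrite pmulr_rle0//.
by case/orP: xab => [xa|bx]; [rewrite mulr_le0_ge0|rewrite mulr_ge0_le0]; lra.
Qed.

Lemma cvg_bump a b x : a <= b -> bump a b n x @[n --> \oo] --> (\1_`]a, b[ x : R).
Proof.
move=> ab; rewrite indicE; have [xab|xab] := boolP (a < x < b).
  rewrite mem_set/= ?in_itv//; apply: cvg_flat0_mulrn.
  by case/andP: xab => ? ?; rewrite mulr_gt0 ?subr_gt0.
rewrite memNset/= ?in_itv/=; last exact/negP.
rewrite (_ : bump a b ^~ x = cst 0); first exact: cvg_cst.
by apply/funext => n; exact: bump_out.
Qed.

End smooth_functions.

Section weak_derivatives.
Context {R : realType}.
Local Notation mu := (@lebesgue_measure R).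
Implicit Types (f g F phi psi : R -> R) (l : R).

Lemma ae_itv_exists (a b : R) (P : R -> Prop) : a < b ->
  {ae mu, forall x, a < x < b -> P x} -> exists2 x, a < x < b & P x.
Proof.
move=> ab [N [mN N0 PN]]; apply: contrapT => nP.
have abN : `]a, b[ `<=` N.
  move=> x /=; rewrite in_itv/= => xab.
  by apply: PN => /= /(_ xab) Px; apply: nP; exists x.
have : mu `]a, b[ = 0%E.
  by apply/eqP; rewrite -measure_le0 -N0; apply: le_measure; rewrite ?inE//.
rewrite lebesgue_measure_itv/= lte_fin ab => /eqP; rewrite -EFinD eqe subr_eq0 => /eqP ba.
by rewrite ba ltxx in ab.
Qed.

Lemma ae_Iol_exhaust l (P : R -> Prop) :
  (forall a b, 0 < a -> b < l -> {ae mu, forall x, a < x < b -> P x}) ->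
  {ae mu, forall x, Iol l x -> P x}.
Proof.
move=> aeP; have aePn n : {ae mu, forall x, n.+1%:R^-1 < x < l - n.+1%:R^-1 -> P x}.
  by apply: aeP; rewrite ?invr_gt0// ltrBlDr ltrDl invr_gt0.
apply: filterS (ae_foralln aePn) => x Px /IolP[x0 xl].
have m0 : 0 < Order.min x (l - x) by rewrite lt_min x0/= subr_gt0.
have [n _ /(_ n (leqnn n))/=] := near_infty_natSinv_lt (PosNum m0).
rewrite lt_min => /andP[nx nlx]; apply: (Px n).
by rewrite nx ltrBrDr addrC -ltrBrDr.
Qed.

Lemma L1loc_ae_eq0 l f : L1loc l f ->
  (forall x y : R, 0 < x -> x < y -> y < l -> \int[mu]_(t in `[x, y]) f t = 0) ->
  ae_eq_on l f (cst 0).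
Proof.
move=> fl f0; apply: ae_Iol_exhaust => a b a0 bl.
have fi := L1loc_integrable fl a0 bl.
pose k := f \_ `[a, b].
have kE : {in `[a, b], k =1 f} by move=> x xab; rewrite /k patchE mem_set.
have ki : mu.-integrable `[a, b] (EFin \o k).
  by apply: eq_integrable fi => //= x /set_mem xab; rewrite kE.
have := lebesgue_differentiation (integrable_locally (measurable_itv _) fi).
apply: filterS => x lx /andP[ax xb].
have [_] := @FTC1_lebesgue_pt _ k (BLeft a) x b xb ki ax lx.
rewrite derive1E (@near_eq_derive _ _ _ _ (cst 0)).
  by rewrite derive_cst kE// in_itv/= !ltW.
near=> y.
have yb : y < b by near: y; exact: lt_nbhsl.
have ay : a < y by near: y; exact: lt_nbhsr.
rewrite -[RHS](f0 a y)//; last exact: lt_trans bl.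
apply: eq_Rintegral => t /set_mem /=; rewrite in_itv/= => /andP[at1 ty].
by rewrite kE// in_itv/= at1 (le_trans ty)// ltW.
Unshelve. all: by end_near. Qed.

Lemma test_fun_continuous l phi : test_fun l phi -> continuous phi.
Proof.
move=> [dphi _] x; apply/differentiable_continuous/derivable1_diffP; exact: (dphi 0%N).
Qed.

Lemma test_fun_bump l (a b : R) n : 0 < a -> a < b -> b < l -> test_fun l (bump a b n).
Proof.
move=> a0 ab bl; split; first exact/smoothP/smooth_bump.
exists a, b; split=> // x /= /negP; rewrite in_itv/= => xab.
apply: bump_out; first exact: ltW.
by apply: contraNN xab => /andP[ax xb]; rewrite !ltW.
Qed.

Lemma test_funD l phi psi : test_fun l phi -> test_fun l psi -> test_fun l (phi + psi).
Proof.
move=> [/smoothP sphi [a [b [a0 ab bl phi0]]]] [/smoothP spsi [c [d [c0 cd dl psi0]]]].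
split; first by apply/smoothP => n; exact: nderivableD.
exists (Order.min a c), (Order.max b d); split.
- by rewrite lt_min a0.
- by rewrite gt_min lt_max ab.
- by rewrite gt_max bl.
move=> x xabcd; rewrite fctE phi0 ?psi0 ?addr0// => xI; apply: xabcd.
  by move: xI; rewrite /= !in_itv/= ge_min le_max => /andP[-> ->]; rewrite !orbT.
by move: xI; rewrite /= !in_itv/= ge_min le_max => /andP[-> ->].
Qed.

Lemma test_funZ l phi (c : R) : test_fun l phi -> test_fun l (cst c * phi).
Proof.
move=> [/smoothP sphi [a [b [a0 ab bl phi0]]]]; split.
  by apply/smoothP => n; apply: nderivableM => //; exact: nderivable_cst.
by exists a, b; split => // x /phi0 phix; rewrite fctE phix mulr0.
Qed.

Lemma derive1_out_itv (a b : R) f : (forall x, ~ `[a, b]%classic x -> f x = 0) ->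
  forall x, ~ `[a, b]%classic x -> derive1 f x = 0.
Proof.
move=> f0 x xab; have : \forall y \near x, ~ `[a, b]%classic y.
  apply: (open_nbhs_nbhs (A := ~` `[a, b])); split => //.
  by apply: closed_openC; exact: interval_closed.
move=> yab; rewrite derive1E (@near_eq_derive _ _ _ f (cst 0)) ?derive_cst//.
by apply: filterS yab => y /f0.
Qed.

Lemma test_fun_derive1 l phi : test_fun l phi -> test_fun l (derive1 phi).
Proof.
move=> [dphi [a [b [a0 ab bl phi0]]]]; split.
  by move=> n x; rewrite -derive1Sn; exact: dphi.
by exists a, b; split => //; exact: derive1_out_itv.
Qed.

Lemma test_fun_primitive_on l phi : test_fun l phi -> primitive_on l phi (derive1 phi).
Proof.
move=> tphi; apply: C1_primitive; last exact: test_fun_continuous (test_fun_derive1 tphi).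
by move=> x; rewrite derive1E; apply/derivableP; have [/(_ 0%N)] := tphi.
Qed.

Lemma integrable_mul_test l f phi : L1loc l f -> test_fun l phi ->
  mu.-integrable (Iol l) (EFin \o (fun x => f x * phi x)).
Proof.
move=> fl tphi; have [_ [a [b [a0 ab bl phi0]]]] := tphi.
have fphil : L1loc l (fun x => f x * phi x).
  under eq_fun do rewrite mulrC.
  by apply: continuous_mul_L1loc fl => x _; exact: test_fun_continuous tphi x.
have abI := subset_itv_Iol a0 bl.
have fphi_patch : (fun x => f x * phi x) \_ `[a, b] = (fun x => f x * phi x).
  apply/funext => x; rewrite patchE; case: ifPn => // /negP nab.
  by rewrite phi0 ?mulr0// => xab; apply: nab; exact: mem_set.
rewrite -fphi_patch -restrict_EFin; apply/integrable_restrict => //.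
by rewrite (setIidr abI); exact: (L1loc_integrable fphil).
Qed.

Lemma test_fun_ae_eq0 l f : L1loc l f ->
  (forall phi, test_fun l phi -> \int[mu]_(x in Iol l) (f x * phi x) = 0) ->
  ae_eq_on l f (cst 0).
Proof.
move=> fl f0; apply: L1loc_ae_eq0 => // a b a0 ab bl.
have fi := L1loc_integrable fl a0 bl; have mf := integrable_measurable fi.
have abI := subset_itv_Iol a0 bl.
have bump_cvg : \int[mu]_(x in `[a, b]) (f x * bump a b n x) @[n --> \oo] -->
    \int[mu]_(x in `[a, b]) (f x * \1_`]a, b[ x).
  apply: (@Rintegral_dominated_cvg _ _ _ mu _ _ (fun n x => f x * bump a b n x) _
    (fun x => `|f x|)) => //.
  - move=> n; apply: measurable_funM => //; apply: measurable_funTS.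
    by apply: continuous_measurable_fun; exact: test_fun_continuous (test_fun_bump n a0 ab bl).
  - exact: measurable_funM.
  - by move=> x _; apply: cvgM; [exact: cvg_cst|apply: cvg_bump; exact: ltW].
  - exact: integrable_norm.
  - by move=> n x _; rewrite normrM ler_piMr// ger0_norm ?bump_ge0 ?bump_le1.
have bump0 n : \int[mu]_(x in `[a, b]) (f x * bump a b n x) = 0.
  rewrite -(f0 _ (test_fun_bump n a0 ab bl)) (Rintegral_supported mu abI)// => x _ xab.
  rewrite bump_out ?mulr0 ?ltW//; apply/negP => /andP[ax xb]; apply: xab.
  by rewrite /= in_itv/= !ltW.
have zero_cvg : \int[mu]_(x in `[a, b]) (f x * bump a b n x) @[n --> \oo] --> (0 : R).
  by under eq_fun do rewrite bump0; exact: cvg_cst.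
have ooab : `]a, b[ `<=` `[a, b] by apply: subset_itv; rewrite bnd_simp.
rewrite -(norm_cvg_unique bump_cvg zero_cvg) [RHS](Rintegral_supported mu ooab).
  transitivity (\int[mu]_(x in `]a, b[) f x).
    rewrite /Rintegral integral_itv_bndoo//.
    by apply/measurable_EFinP; apply: measurable_funS mf.
  by apply: eq_Rintegral => x xab; rewrite indicE xab mulr1.
by move=> x _ xab; rewrite indicE memNset ?mulr0.
Qed.

Lemma test_fun_primitive l phi : test_fun l phi -> \int[mu]_(x in Iol l) phi x = 0 ->
  exists2 psi, test_fun l psi & derive1 psi = phi.
Proof.
move=> tphi; have cphi := test_fun_continuous tphi.
have [/smoothP sphi [a [b [a0 ab bl phi0]]]] := tphi => int0.
pose psi x := \int[mu]_(t in `[0, x]) phi t.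
have psi_left x : x < a -> psi x = 0.
  move=> xa; rewrite /psi (@eq_Rintegral _ _ _ _ _ (cst 0)) ?Rintegral_cst ?mul0r//.
  move=> t; rewrite inE/= in_itv/= => /andP[_ tx]; apply: phi0; rewrite /= in_itv/=.
  by apply/negP; lra.
have psi_right x : b < x -> psi x = 0.
  move=> bx; rewrite -int0 /psi (Rintegral_supported mu (subset_itv_Iol a0 bl)).
    rewrite (Rintegral_supported mu (A := `[a, b]))//; last by move=> t _; exact: phi0.
    by apply: subset_itv; rewrite bnd_simp ltW.
  by move=> t _; exact: phi0.
have dpsi (x : R) : is_derive x 1 psi (phi x).
  have [xa|ax] := ltP x a.
    rewrite phi0; last by rewrite /= in_itv/=; apply/negP; lra.
    apply: (@near_eq_is_derive _ _ _ (cst 0)); near=> y.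
    by rewrite psi_left//; near: y; exact: lt_nbhsl.
  have phii : mu.-integrable `[0, x + 1] (EFin \o phi).
    apply: continuous_compact_integrable; first exact: segment_compact.
    exact: continuous_subspaceT.
  have xx1 : x < x + 1 by rewrite ltrDl.
  have [dpsi <-] := continuous_FTC1_closed xx1 phii (lt_le_trans a0 ax) (cphi x).
  by rewrite derive1E; exact: derivableP.
have psi' : derive1 psi = phi.
  by apply/funext => x; rewrite derive1E; case: (dpsi x).
exists psi => //; split.
  apply/smoothP => -[//|n]; split; first by move=> x; case: (dpsi x).
  by rewrite psi'; exact: sphi.
exists a, b; split=> // x; rewrite /= in_itv/= => /negP; rewrite negb_and -!ltNge.
by move=> /orP[/psi_left|/psi_right].
Unshelve. all: by end_near. Qed.

Lemma integrable_test_fun l phi : test_fun l phi -> mu.-integrable (Iol l) (EFin \o phi).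
Proof.
move=> /(integrable_mul_test (cst_L1loc l 1)); apply: eq_integrable => // x _.
by rewrite /= mul1r.
Qed.

Lemma test_fun_integral1 l : 0 < l ->
  exists2 phi, test_fun l phi & \int[mu]_(x in Iol l) phi x = 1.
Proof.
move=> l0; have [[phi tphi phi_n0]|phi0] := pselect
    (exists2 phi, test_fun l phi & \int[mu]_(x in Iol l) phi x != 0).
  exists (cst (\int[mu]_(x in Iol l) phi x)^-1 * phi); first exact: test_funZ.
  by rewrite RintegralZl ?mulVf//; exact: integrable_test_fun.
have /ae_itv_exists-/(_ l0)[x _] : {ae mu, forall x, 0 < x < l -> (1 : R) = 0}.
  have : ae_eq_on l (cst 1) (cst 0).
    apply: test_fun_ae_eq0 (cst_L1loc l 1) _ => phi tphi; under eq_Rintegral do rewrite mul1r.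
    by apply/eqP; apply: contra_notT phi0 => ?; exists phi.
  by apply: filterS => x one0 /andP[x0 xl]; apply: one0; exact/IolP.
by move/eqP; rewrite oner_eq0.
Qed.

(* Du Bois-Reymond: modulo a multiple of a fixed test function of integral [1], every test
   function is the derivative of a test function. *)
Lemma derive1_orthogonal_cst l f : 0 < l -> L1loc l f ->
  (forall phi, test_fun l phi -> \int[mu]_(x in Iol l) (f x * derive1 phi x) = 0) ->
  exists c, ae_eq_on l f (cst c).
Proof.
move=> l0 fl fphi0; have [theta ttheta theta1] := test_fun_integral1 l0.
pose c := \int[mu]_(x in Iol l) (f x * theta x).
exists c; apply: ae_subr_eq0.
apply: (@test_fun_ae_eq0 _ (f \- cst c)); first by apply: L1locB => //; exact: cst_L1loc.
move=> phi tphi; pose I := \int[mu]_(x in Iol l) phi x.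
have phii := integrable_test_fun tphi; have thetai := integrable_test_fun ttheta.
have tchi : test_fun l (phi + cst (- I) * theta) by apply: test_funD => //; exact: test_funZ.
have chi0 : \int[mu]_(x in Iol l) (phi + cst (- I) * theta) x = 0.
  rewrite RintegralD//; last exact: integrable_EFinZ.
  by rewrite RintegralZl// theta1 mulr1 subrr.
have [psi tpsi psi'] := test_fun_primitive tchi chi0.
have [fphii fthetai] := (integrable_mul_test fl tphi, integrable_mul_test fl ttheta).
have := fphi0 _ tpsi; rewrite psi'.
have -> : \int[mu]_(x in Iol l) (f x * (phi + cst (- I) * theta) x) =
    \int[mu]_(x in Iol l) (f x * phi x) - I * c.
  rewrite -RintegralZl// -RintegralB//; last exact: integrable_EFinZ.
  by apply: eq_Rintegral => x _; rewrite !fctE; ring.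
move=> <-; rewrite mulrC -RintegralZl// -RintegralB//; last exact: integrable_EFinZ.
by apply: eq_Rintegral => x _; rewrite mulrBl.
Qed.

Lemma primitive_weak_deriv l F f : primitive_on l F f -> weak_deriv l F f.
Proof.
move=> Ff; have cF := primitive_continuous Ff; have [fl _] := Ff.
split; first exact: continuous_L1loc.
split=> // phi tphi; have tphi' := test_fun_derive1 tphi.
have Fphi'i := integrable_mul_test (continuous_L1loc cF) tphi'.
have fphii := integrable_mul_test fl tphi.
apply/eqP; rewrite -addr_eq0 -RintegralD//; apply/eqP.
have [_ [a [b [a0 ab bl phi0]]]] := tphi.
have phi'0 := derive1_out_itv phi0.
have [_ incr] := primitiveM Ff (test_fun_primitive_on tphi).
pose a' := a / 2; pose b' := (b + l) / 2.
have [a'0 a'a b'b b'l] : [/\ 0 < a', a' < a, b < b' & b' < l] by rewrite /a' /b'; split; lra.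
have supp : `[a', b'] `<=` Iol l by exact: subset_itv_Iol.
rewrite (Rintegral_supported mu supp).
  transitivity ((F \* phi) b' - (F \* phi) a').
    by rewrite incr//; [apply: eq_Rintegral => x _; ring|lra].
  by rewrite /= !phi0 ?mulr0 ?subrr//= in_itv/=; apply/negP; lra.
move=> x _ xab'; have xab : ~ `[a, b]%classic x.
  by apply: contra_not xab'; apply: subset_itv; rewrite bnd_simp ltW.
by rewrite phi0// phi'0// !mulr0 addr0.
Qed.

Lemma weak_derivB l f g f' g' : weak_deriv l f g -> weak_deriv l f' g' ->
  weak_deriv l (f \- f') (g \- g').
Proof.
move=> [fl [gl fg]] [fl' [gl' fg']]; split; first exact: L1locB.
split=> [|phi tphi]; first exact: L1locB.
have tphi' := test_fun_derive1 tphi.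
under eq_Rintegral do rewrite mulrBl.
under [X in _ = - X]eq_Rintegral do rewrite mulrBl.
by rewrite !RintegralB ?fg ?fg'//; [ring|exact: integrable_mul_test..].
Qed.

Lemma weak_deriv_uniq l f g f' g' : weak_deriv l f g -> weak_deriv l f' g' ->
  ae_eq_on l f f' -> ae_eq_on l g g'.
Proof.
move=> [fl [gl fg]] [fl' [gl' fg']] ff'.
apply: ae_subr_eq0; apply: (@test_fun_ae_eq0 _ (g \- g')); first exact: L1locB.
move=> phi tphi; have tphi' := test_fun_derive1 tphi.
under eq_Rintegral do rewrite mulrBl.
rewrite RintegralB//; [|exact: integrable_mul_test..].
apply: oppr_inj; rewrite opprB oppr0 addrC -fg// -[X in _ + X]opprK -fg'//.
apply/eqP; rewrite subr_eq0; apply/eqP/eq_Rintegral_ae => //.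
- by apply: integrable_measurable; exact: integrable_mul_test.
- by apply: integrable_measurable; exact: integrable_mul_test.
- by apply: filterS ff' => x ff' xl; rewrite ff'.
Qed.

Lemma weak_deriv_primitive l f g : 0 < l -> weak_deriv l f g ->
  exists2 F, primitive_on l F g & ae_eq_on l f F.
Proof.
move=> l0 fg; have [fl [gl _]] := fg; have [G Gg] := primitive_exists l0 gl.
have [hl [_ h']] := weak_derivB fg (primitive_weak_deriv Gg).
have [phi tphi|c fGc] := derive1_orthogonal_cst l0 hl.
  rewrite h'// (@eq_Rintegral _ _ _ _ _ (cst 0)) ?Rintegral_cst ?mul0r ?oppr0//.
  by move=> x _ /=; rewrite subrr mul0r.
exists (fun x => G x + c).
  by split=> // x y x0 xy yl; rewrite -(Gg.2 x y)//; ring.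
by apply: filterS fGc => x /[apply] /= <-; rewrite addrC subrK.
Qed.

End weak_derivatives.

Section boundary_behaviour.
Context {R : realType}.
Local Notation mu := (@lebesgue_measure R).
Implicit Types (f h F G : R -> R) (l c x y : R).

Lemma lebesgue_measure_Iol_lty l : (mu (Iol l) < +oo)%E.
Proof. by rewrite /Iol lebesgue_measure_itv/=; case: ifP => // _; rewrite ltry. Qed.

Lemma isL2E l f : isL2 l f = sqr_integrable mu (Iol l) f.
Proof. by []. Qed.

Lemma isL2_integrable l f : isL2 l f -> mu.-integrable (Iol l) (EFin \o f).
Proof.
by rewrite isL2E; apply: sqr_integrable_integrable => //; exact: lebesgue_measure_Iol_lty.
Qed.

(* The integrals of [h] over the intervals [x, 2 x] would be bounded away from [0]. *)
Lemma inv_not_integrable l h c y : 0 < y -> y <= l -> 0 < c ->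
  mu.-integrable (Iol l) (EFin \o h) -> ~ {ae mu, forall x, 0 < x < y -> c / x <= h x}.
Proof.
move=> y0 yl c0 hi hc; pose k := h \_ (Iol l).
have ki : mu.-integrable setT (EFin \o k) by exact: integrable_patch.
have c20 : 0 < c / 2 by lra.
have [d [d0 small]] := integral_normr_continuous ki c20.
pose x := Order.min (d / 2) (y / 4).
have x0 : 0 < x by rewrite lt_min; apply/andP; split; lra.
have xd : x <= d / 2 by rewrite ge_min lexx.
have xy : x <= y / 4 by rewrite ge_min lexx orbT.
pose A := `[x, 2 * x]%classic; have mA : measurable A by exact: measurable_itv.
have AI : A `<=` Iol l by apply: subset_itv_Iol; lra.
have muA : mu A = x%:E.
  rewrite /A lebesgue_measure_itv/= lte_fin ifT; last lra.
  by rewrite -EFinD; congr EFin; ring.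
have : \int[mu]_(t in A) `|k t| < c / 2.
  by apply: small => //; apply: (@le_lt_trans _ _ x%:E); [rewrite -muA|rewrite lte_fin; lra].
apply/negP; rewrite -leNgt.
have kA : mu.-integrable A (EFin \o (fun t => `|k t|)).
  by apply: integrable_norm; exact: integrableS ki.
have -> : c / 2 = \int[mu]_(t in A) (c / (2 * x)).
  by rewrite Rintegral_cst//= muA/=; field; rewrite gt_eqF.
rewrite /Rintegral; apply: fine_le.
- by apply: integrable_fin_num => //; apply: integrable_EFin_cst; rewrite //= muA ltry.
- exact: integrable_fin_num.
apply: ae_ge0_le_integral => //.
- by move=> t _; rewrite lee_fin divr_ge0//; lra.
- by apply/measurable_EFinP; exact: (integrable_measurable kA).
apply: filterS hc => t hc At; rewrite lee_fin.
have tI := AI _ At; move: At; rewrite /A/= in_itv/= => /andP[xt t2].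
rewrite /k patchE mem_set//; apply: le_trans (ler_norm _); apply: le_trans (hc _); last lra.
by rewrite ler_pM2l// lef_pV2// posrE; lra.
Qed.

Lemma cvg_eq0_sqr_le_mul l F h c : 0 < l -> F x @[x --> 0^'+] --> c ->
  mu.-integrable (Iol l) (EFin \o h) ->
  {ae mu, forall x, Iol l x -> F x ^+ 2 <= x * h x} -> c = 0.
Proof.
move=> l0 Fc hi Fh; apply/eqP/negPn/negP => c0.
have sqrc0 : 0 < c ^+ 2 by rewrite exprn_even_gt0.
have sqr_cvg : F x ^+ 2 @[x --> 0^'+] --> c ^+ 2 by exact: cvgM.
have [d /= d0 Fd] : \forall x \near 0^'+, c ^+ 2 / 2 < F x ^+ 2.
  by apply: (cvgr_gt _ sqr_cvg); lra.
apply: (@inv_not_integrable l h (c ^+ 2 / 2) (Order.min d l)) => //.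
- by rewrite lt_min d0.
- by rewrite ge_min lexx orbT.
- by lra.
apply: filterS Fh => x Fh /andP[x0]; rewrite lt_min => /andP[xd xl].
rewrite ler_pdivrMr// [leRHS]mulrC; apply: (le_trans _ (Fh ((IolP l x).2 (conj x0 xl)))).
by apply/ltW/Fd => //=; rewrite sub0r normrN gtr0_norm.
Qed.

Lemma continuous_ae_eq l F G : {in Iol l, continuous F} -> {in Iol l, continuous G} ->
  ae_eq_on l F G -> forall x, Iol l x -> F x = G x.
Proof.
move=> cF cG FG x xI; apply/eqP; rewrite -subr_eq0; apply/negPn/negP => FGx.
have FGc : F t - G t @[t --> x] --> F x - G x.
  by apply: cvgB; [apply: cF|apply: cG]; exact: mem_set.
have [d /= d0 FGd] : \forall t \near x, F t - G t != 0 /\ Iol l t.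
  near=> t; split; near: t; first exact: cvgr_neq0 FGc FGx.
  by apply: open_nbhs_nbhs; split => //; exact: open_Iol.
have xd : x - d < x + d by lra.
have FGball t : x - d < t < x + d -> F t - G t != 0 /\ Iol l t.
  by move=> xtd; apply: FGd; rewrite /= distrC ltr_distl.
have [t xtd FGt] : exists2 t, x - d < t < x + d & F t = G t.
  apply: ae_itv_exists => //; apply: filterS FG => t FG /FGball[_ tI]; exact: FG.
by have [] := FGball t xtd; rewrite FGt subrr eqxx.
Unshelve. all: by end_near. Qed.

Lemma primitive_sqr_increment_le l F f x y : primitive_on l F f -> isL2 l f ->
  0 < x -> x <= y -> y < l -> (F y - F x) ^+ 2 <= (y - x) * sqnormL2 mu (Iol l) f.
Proof.
move=> [fl Ff]; rewrite isL2E => fL2 x0 xy yl; have xyI := subset_itv_Iol x0 yl.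
have [_ f2i] := (sqr_integrableP _ _ _).1 fL2.
have oneL2 : sqr_integrable mu `[x, y] (cst 1).
  apply: sqr_integrable_cst => //; apply: compact_finite_measure; exact: segment_compact.
have fL2xy : sqr_integrable mu `[x, y] f by apply: sqr_integrableS fL2.
have := dotL2_sqr_le (mu := mu) (measurable_itv _) oneL2 fL2xy.
have -> : dotL2 mu `[x, y] (cst 1) f = F y - F x.
  by rewrite Ff//; apply: eq_Rintegral => t _; rewrite mul1r.
have -> : sqnormL2 mu `[x, y] (cst 1) = y - x.
  rewrite /sqnormL2; under eq_Rintegral do rewrite expr1n.
  rewrite Rintegral_cst//= mul1r lebesgue_measure_itv/= lte_fin.
  by case: ltgtP xy => //= -> _; rewrite subrr.
move=> /le_trans; apply; rewrite ler_wpM2l ?subr_ge0//.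
apply: Rintegral_subset_ge0 => // t _; exact: sqr_ge0.
Qed.

Lemma primitiveZ l F f c : primitive_on l F f ->
  primitive_on l (fun x => c * F x) (fun x => c * f x).
Proof.
move=> [[mf fi] Ff]; split.
  split; first exact: measurable_funM.
  by move=> a b a0 ab bl; apply: integrable_EFinZ => //; exact: fi.
move=> x y x0 xy yl; rewrite RintegralZl//; last exact: (L1loc_integrable (conj mf fi)).
by rewrite -Ff// mulrBr.
Qed.

Lemma primitive_nondecreasing l F f : primitive_on l F f ->
  {ae mu, forall x, Iol l x -> 0 <= f x} -> {in Iol l &, {homo F : x y / x <= y}}.
Proof.
move=> [fl Ff] f0 x y /set_mem/IolP[x0 _] /set_mem/IolP[_ yl] xy; rewrite -subr_ge0 Ff//.
have mf := integrable_measurable (L1loc_integrable fl x0 yl).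
rewrite (@eq_Rintegral_ae _ _ _ mu _ _ f (fun t => `|f t|))//.
- by apply: Rintegral_ge0.
- exact: measurableT_comp.
apply: filterS f0 => t f0 /(subset_itv_Iol x0 yl)/f0 ft.
by rewrite /= ger0_norm.
Qed.

End boundary_behaviour.

Lemma sqr_det_le (R : realFieldType) (p q u v A B x : R) : 0 <= A -> 0 <= B -> 0 <= x ->
  p ^+ 2 <= x * A -> q ^+ 2 <= x * B ->
  (p * v - u * q) ^+ 2 <= x * (2 * (A + B) * (u ^+ 2 + v ^+ 2)).
Proof.
move=> A0 B0 x0 pA qB.
have pv : p ^+ 2 * v ^+ 2 <= x * A * v ^+ 2 by rewrite ler_wpM2r ?sqr_ge0.
have uq : u ^+ 2 * q ^+ 2 <= u ^+ 2 * (x * B) by rewrite ler_wpM2l ?sqr_ge0.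
have cross0 : 0 <= x * (A * u ^+ 2 + B * v ^+ 2).
  by rewrite mulr_ge0// addr_ge0// mulr_ge0// sqr_ge0.
have := sqr_ge0 (p * v + u * q); lra.
Qed.

Section degenerate_operator.
Context {R : realType}.
Local Notation mu := (@lebesgue_measure R).
Local Notation dot l f g := (dotL2 mu (Iol l) f g).
Local Notation sqnorm l f := (sqnormL2 mu (Iol l) f).
Implicit Types (u v w z g h U V P Q : R -> R) (l a x : R).

(* An element [U] of the domain of the operator, given by its continuous representative,
   with its derivative [g], its flux [P = x^a g] and its image [w = P']. *)
Record domain_rep l a U g P w : Prop := DomainRep {
  rep_deriv : primitive_on l U g;
  rep_flux_deriv : primitive_on l P w;
  rep_flux : ae_eq_on l (fun x => x `^ a * g x) P;
  rep_cvg_left : U x @[x --> l^'-] --> 0;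
  rep_cvg_right : a < 1 -> U x @[x --> 0^'+] --> 0;
  rep_isL2 : isL2 l U;
  rep_image_isL2 : isL2 l w;
  rep_energy : mu.-integrable (Iol l) (EFin \o (fun x => x `^ a * g x ^+ 2)) }.

Lemma A_op_domain_rep l a u w : 0 < l -> A_op l a u w ->
  exists U g P, ae_eq_on l u U /\ domain_rep l a U g P w.
Proof.
move=> l0 [[uL [[g' [ug' g'energy]] [U [cU uU U_left U_right]]]] [g [ug _ fluxw wL]]].
have [U' U'g uU'] := weak_deriv_primitive l0 ug.
have [P Pw fluxP] := weak_deriv_primitive l0 fluxw.
have UU' : forall x, Iol l x -> U' x = U x.
  apply: continuous_ae_eq => //; first exact: primitive_continuous U'g.
  by apply: filterS2 uU uU' => x uU uU' xl; rewrite -uU// -uU'.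
have gg' : ae_eq_on l g g' by apply: weak_deriv_uniq ug ug' _; exact: nearW.
have energy_measurable (h : R -> R) : measurable_fun (Iol l) h ->
    measurable_fun (Iol l) (fun x => x `^ a * h x ^+ 2).
  move=> mh; apply: measurable_funM; last exact: measurable_funX.
  by apply: measurable_funTS; exact: measurable_powR.
have energy_ge0 (h : R -> R) x : Iol l x -> 0 <= x `^ a * h x ^+ 2.
  by rewrite mulr_ge0 ?powR_ge0 ?sqr_ge0.
have mg : measurable_fun (Iol l) g by case: ug => _ [[]].
have mg' : measurable_fun (Iol l) g' by case: ug' => _ [[]].
exists U, g, P; split=> //; split => //; first exact: primitive_eq_on UU' U'g.
  by rewrite isL2E in uL *; apply: sqr_integrable_ae uL => //; exact: continuous_measurable_Iol.
apply: (@eq_integrable_ae _ _ _ mu _ _ (fun x => x `^ a * g' x ^+ 2)) => //.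
- exact: energy_measurable.
- by apply: filterS gg' => x gg' xl; rewrite gg'.
by apply/integrable_ge0P => //; [exact: energy_measurable|exact: energy_ge0].
Qed.

Lemma flux_cvg_ends l a U g P w : 0 < l -> domain_rep l a U g P w ->
  exists p q : R, P x @[x --> 0^'+] --> p /\ P x @[x --> l^'-] --> q.
Proof.
move=> l0 rep; have wi := isL2_integrable (rep_image_isL2 rep).
have [p P0 Pl] := primitive_cvg_ends l0 (rep_flux_deriv rep) wi.
by exists p, (p + \int[mu]_(x in Iol l) w x).
Qed.

Lemma flux_cvg_right_strong l a U g P w : 0 < l -> l <= 1 -> 1 <= a -> domain_rep l a U g P w ->
  P x @[x --> 0^'+] --> 0.
Proof.
move=> l0 l1 a1 rep.
have [c [_ [Pc _]]] := flux_cvg_ends l0 rep.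
suff c0 : c = 0 by rewrite c0 in Pc.
apply: cvg_eq0_sqr_le_mul l0 Pc (rep_energy rep) _.
apply: filterS (rep_flux rep) => x fluxP xI; have /IolP[x0 xl] := xI.
have xax : x `^ a <= x by apply: ge1r_powR => //; rewrite x0/=; lra.
rewrite -fluxP// exprMn expr2 -mulrA ler_wpM2r//.
by rewrite mulr_ge0 ?powR_ge0 ?sqr_ge0.
Qed.

Lemma flux_sqr_le_strong l a U g P w x : 0 < l -> l <= 1 -> 1 <= a -> domain_rep l a U g P w ->
  Iol l x -> P x ^+ 2 <= x * sqnorm l w.
Proof.
move=> l0 l1 a1 rep /IolP[x0 xl]; have P0 := flux_cvg_right_strong l0 l1 a1 rep.
have Px : (P x - P y) ^+ 2 @[y --> 0^'+] --> (P x - 0) ^+ 2.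
  by apply: cvgM; (apply: cvgB => //; exact: cvg_cst).
rewrite -[P x]subr0; apply: (cvgr_to_le Px); near=> y.
have y0 : 0 < y by near: y; exact: nbhs_right_gt.
have yx : y <= x by near: y; exact: nbhs_right_ltW.
apply: le_trans (primitive_sqr_increment_le (rep_flux_deriv rep) (rep_image_isL2 rep) y0 yx xl) _.
by rewrite ler_wpM2r ?sqnormL2_ge0// gerBl ltW.
Unshelve. all: by end_near. Qed.

Section wronskian.
Variables (l a : R) (U g P w V h Q z : R -> R).
Hypotheses (l0 : 0 < l) (l1 : l <= 1).
Hypotheses (repU : domain_rep l a U g P w) (repV : domain_rep l a V h Q z).

Definition wronskian := (P \* V) \- (U \* Q).

Let integrable_wV : mu.-integrable (Iol l) (EFin \o (fun x => w x * V x)).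
Proof. by apply: sqr_integrable_mul; rewrite -?isL2E; [|case: repU|case: repV]. Qed.

Let integrable_Uz : mu.-integrable (Iol l) (EFin \o (fun x => U x * z x)).
Proof. by apply: sqr_integrable_mul; rewrite -?isL2E; [|case: repU|case: repV]. Qed.

Let integrable_wronskian_deriv : mu.-integrable (Iol l) (EFin \o (fun x => w x * V x - U x * z x)).
Proof. exact: (integrable_EFinB _ integrable_wV integrable_Uz). Qed.

Lemma wronskian_deriv : primitive_on l wronskian (fun x => w x * V x - U x * z x).
Proof.
have PV := primitiveM (rep_flux_deriv repU) (rep_deriv repV).
have UQ := primitiveM (rep_deriv repU) (rep_flux_deriv repV).
apply: (eq_ae_primitive (primitiveB PV UQ)); first exact: integrable_L1loc.
apply: filterS2 (rep_flux repU) (rep_flux repV) => x fluxU fluxV xl.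
by rewrite /= -fluxU// -fluxV//; ring.
Qed.

Lemma wronskian_cvg_left : wronskian x @[x --> l^'-] --> 0.
Proof.
have [_ [p [_ Pp]]] := flux_cvg_ends l0 repU; have [_ [q [_ Qq]]] := flux_cvg_ends l0 repV.
have : wronskian x @[x --> l^'-] --> p * 0 - 0 * q.
  by apply: cvgB; apply: cvgM => //; [exact: rep_cvg_left repV|exact: rep_cvg_left repU].
by rewrite mulr0 mul0r subr0.
Qed.

Lemma wronskian_cvg_right_weak : a < 1 -> wronskian x @[x --> 0^'+] --> 0.
Proof.
move=> a1; have [p [_ [Pp _]]] := flux_cvg_ends l0 repU.
have [q [_ [Qq _]]] := flux_cvg_ends l0 repV.
have : wronskian x @[x --> 0^'+] --> p * 0 - 0 * q.
  by apply: cvgB; apply: cvgM => //; [exact: rep_cvg_right repV a1|exact: rep_cvg_right repU a1].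
by rewrite mulr0 mul0r subr0.
Qed.

Lemma wronskian_sqr_le_strong x : 1 <= a -> Iol l x ->
  wronskian x ^+ 2 <= x * (2 * (sqnorm l w + sqnorm l z) * (U x ^+ 2 + V x ^+ 2)).
Proof.
move=> a1 xI; have [x0 _] := (IolP l x).1 xI.
by apply: sqr_det_le; rewrite ?sqnormL2_ge0 ?(ltW x0)//;
  [exact: flux_sqr_le_strong repU xI|exact: flux_sqr_le_strong repV xI].
Qed.

Lemma wronskian_cvg_right_strong : 1 <= a -> wronskian x @[x --> 0^'+] --> 0.
Proof.
move=> a1; have [c Wc _] := primitive_cvg_ends l0 wronskian_deriv integrable_wronskian_deriv.
have U2V2 : mu.-integrable (Iol l) (EFin \o (fun x =>
    2 * (sqnorm l w + sqnorm l z) * (U x ^+ 2 + V x ^+ 2))).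
  apply: integrable_EFinZ => //; apply: integrable_EFinD => //.
    by have := rep_isL2 repU; rewrite isL2E => /sqr_integrableP[].
  by have := rep_isL2 repV; rewrite isL2E => /sqr_integrableP[].
suff c0 : c = 0 by rewrite c0 in Wc.
by apply: cvg_eq0_sqr_le_mul l0 Wc U2V2 _; apply: nearW => x; exact: wronskian_sqr_le_strong.
Qed.

Lemma domain_rep_symmetric : dot l w V = dot l U z.
Proof.
have [c W0 Wl] := primitive_cvg_ends l0 wronskian_deriv integrable_wronskian_deriv.
have c0 : c = 0.
  have [a1|a1] := ltP a 1.
    exact: (norm_cvg_unique W0 (wronskian_cvg_right_weak a1)).
  exact: (norm_cvg_unique W0 (wronskian_cvg_right_strong a1)).
have : c + \int[mu]_(x in Iol l) (w x * V x - U x * z x) = 0.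
  exact: (norm_cvg_unique Wl wronskian_cvg_left).
by rewrite c0 add0r RintegralB// => /eqP; rewrite subr_eq0 => /eqP.
Qed.

End wronskian.

Lemma A_op_symmetric l a u w v z : 0 < l -> l <= 1 ->
  A_op l a u w -> A_op l a v z -> dot l w v = dot l u z.
Proof.
move=> l0 l1 Au Av.
have [U [g [P [uU repU]]]] := A_op_domain_rep l0 Au.
have [V [h [Q [vV repV]]]] := A_op_domain_rep l0 Av.
have [[[u_measurable _] _] [_ [_ _ _ [w_measurable _]]]] := Au.
have [[[v_measurable _] _] [_ [_ _ _ [z_measurable _]]]] := Av.
have mU := continuous_measurable_Iol (primitive_continuous (rep_deriv repU)).
have mV := continuous_measurable_Iol (primitive_continuous (rep_deriv repV)).
have -> : dot l w v = dot l w V.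
  by apply: eq_Rintegral_ae => //; [exact: measurable_funM..|apply: filterS vV => x vV /vV ->].
rewrite (domain_rep_symmetric l0 l1 repU repV).
by apply: eq_Rintegral_ae => //; [exact: measurable_funM..|apply: filterS uU => x uU /uU ->].
Qed.

End degenerate_operator.

Section identification.
Context {R : realType}.
Local Notation mu := (@lebesgue_measure R).
Implicit Types (F : R -> R) (l a x : R).

Lemma gtr_powR x : 0 < x < 1 -> {homo powR x : a b /~ b < a}.
Proof.
move=> /andP[x0 x1] a b ab; rewrite /powR gt_eqF// ltr_expR ltr_nM2r//.
by rewrite ln_lt0// x0.
Qed.

Lemma nondecreasing_le0_cvg_left l F :
  {in Iol l &, {homo F : x y / x <= y}} -> F x @[x --> l^'-] --> 0 ->
  forall x, Iol l x -> F x <= 0.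
Proof.
move=> ndF Fl x xI; have [x0 xl] := (IolP l x).1 xI.
apply: (cvgr_to_ge Fl); near=> y; apply: ndF; first exact: mem_set.
  by apply: mem_set; near: y; apply: nbhs_left_Iol; exact: lt_trans xl.
by near: y; exact: nbhs_left_ge.
Unshelve. all: by end_near. Qed.

Lemma nondecreasing_ge0_cvg_right l F :
  {in Iol l &, {homo F : x y / x <= y}} -> F x @[x --> 0^'+] --> 0 ->
  forall x, Iol l x -> 0 <= F x.
Proof.
move=> ndF F0 x xI; have [x0 xl] := (IolP l x).1 xI.
apply: (cvgr_to_le F0); near=> y; apply: ndF; last by near: y; exact: nbhs_right_ltW.
  by apply: mem_set; near: y; apply: nbhs_right0_Iol; exact: lt_trans xl.
exact: mem_set.
Unshelve. all: by end_near. Qed.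

Section same_derivatives.
Variables (l a1 a2 : R) (U1 U2 g1 g2 P1 P2 w1 w2 : R -> R).
Hypotheses (l0 : 0 < l) (l1 : l <= 1) (a12 : a1 < a2).
Hypotheses (rep1 : domain_rep l a1 U1 g1 P1 w1) (rep2 : domain_rep l a2 U2 g2 P2 w2).
Hypotheses (g12 : ae_eq_on l g1 g2) (w12 : ae_eq_on l w1 w2).

Lemma flux_difference_cst :
  exists c, {ae mu, forall x, Iol l x -> (x `^ a1 - x `^ a2) * g1 x = c}.
Proof.
have w1loc : L1loc l w1 by case: (rep_flux_deriv rep1).
have P2w1 : primitive_on l P2 w1.
  by apply: (eq_ae_primitive (rep_flux_deriv rep2)) => //; exact: ae_eq_sym w12.
have [c P12] := primitive_cst_diff (rep_flux_deriv rep1) P2w1.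
exists c; apply: filterS3 (rep_flux rep1) (rep_flux rep2) g12 => x flux1 flux2 gx xI.
by rewrite mulrBl flux1// gx// flux2// P12// addrC addKr.
Qed.

Variable c : R.
Hypothesis g1c : {ae mu, forall x, Iol l x -> (x `^ a1 - x `^ a2) * g1 x = c}.

Lemma powRB_gt0 x : Iol l x -> 0 < x `^ a1 - x `^ a2.
Proof. by move=> /IolP[x0 xl]; rewrite subr_gt0 gtr_powR// x0 (lt_le_trans xl). Qed.

Lemma flux_difference_eq0 : 1 <= a1 -> c = 0.
Proof.
move=> a1ge; apply: (cvg_eq0_sqr_le_mul l0 (cvg_cst c) (rep_energy rep1)).
apply: filterS g1c => x /[swap] xI /(_ xI) gx; have /IolP[x0 xl] := xI.
have xax : x `^ a1 <= x by rewrite ge1r_powR// x0 (le_trans (ltW xl)).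
have [p12 q0] := (powRB_gt0 xI, powR_ge0 x a2).
by rewrite -gx exprMn [leRHS]mulrA ler_wpM2r ?sqr_ge0// expr2; apply: ler_pM; lra.
Qed.

Lemma mul_rep_nondecreasing (s : R) : 0 <= s * c ->
  {in Iol l &, {homo (fun x => s * U1 x) : x y / x <= y}}.
Proof.
move=> sc0; apply: primitive_nondecreasing (primitiveZ s (rep_deriv rep1)) _.
apply: filterS g1c => x /[swap] xI /(_ xI) gx; have p12 := powRB_gt0 xI.
by move: sc0; rewrite -gx mulrCA pmulr_rge0.
Qed.

Lemma same_derivatives_eq0 x : Iol l x -> U1 x = 0.
Proof.
move=> xI; have cvgZ_left s : s * U1 y @[y --> l^'-] --> (0 : R).
  by rewrite -(mulr0 s); apply: cvgM; [exact: cvg_cst|exact: rep_cvg_left rep1].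
have le0 s : 0 <= s * c -> s * U1 x <= 0.
  by move=> /mul_rep_nondecreasing ndU; exact: nondecreasing_le0_cvg_left ndU _ _ xI.
have [c0|c0] := eqVneq c 0.
  by have := (le0 1, le0 (-1)); rewrite c0 !mulr0 lexx => -[/(_ isT) + /(_ isT)]; lra.
have a1lt : a1 < 1 by rewrite ltNge; apply: contraNN c0 => /flux_difference_eq0 ->.
have cc0 : 0 <= c * c by rewrite -expr2 sqr_ge0.
have : c * U1 y @[y --> 0^'+] --> c * 0.
  by apply: cvgM; [exact: cvg_cst|exact: rep_cvg_right rep1 a1lt].
rewrite mulr0 => cU_right.
have cU0 : c * U1 x = 0.
  apply/le_anti; rewrite le0//=.
  exact: nondecreasing_ge0_cvg_right (mul_rep_nondecreasing cc0) cU_right _ xI.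
by move/eqP: cU0; rewrite mulf_eq0 (negPf c0) => /eqP.
Qed.

End same_derivatives.

Lemma A_op_same_derivatives_eq0 l a1 a2 u1 u2 w1 w2 g1 g2 : 0 < l -> l <= 1 -> a1 < a2 ->
  A_op l a1 u1 w1 -> A_op l a2 u2 w2 -> ae_eq_on l w1 w2 ->
  weak_deriv l u1 g1 -> weak_deriv l u2 g2 -> ae_eq_on l g1 g2 -> ae_eq_on l u1 (cst 0).
Proof.
move=> l0 l1 a12 A1 A2 w12 ug1 ug2 g12.
have [U1 [h1 [P1 [uU1 rep1]]]] := A_op_domain_rep l0 A1.
have [U2 [h2 [P2 [uU2 rep2]]]] := A_op_domain_rep l0 A2.
have gh1 := weak_deriv_uniq ug1 (primitive_weak_deriv (rep_deriv rep1)) uU1.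
have gh2 := weak_deriv_uniq ug2 (primitive_weak_deriv (rep_deriv rep2)) uU2.
have h12 : ae_eq_on l h1 h2.
  by apply: filterS3 gh1 gh2 g12 => x gh1 gh2 g12 xI; rewrite -gh1// -gh2// g12.
have [c h1c] := flux_difference_cst rep1 rep2 h12 w12.
by apply: filterS uU1 => x uU1 xI; rewrite uU1// (same_derivatives_eq0 l0 l1 a12 rep1 h1c).
Qed.

End identification.

Section time_derivatives.
Context {R : realType}.
Local Notation mu := (@lebesgue_measure R).
Local Notation dot l f g := (dotL2 mu (Iol l) f g).
Local Notation sqnorm l f := (sqnormL2 mu (Iol l) f).
Local Notation L2 l f := (sqr_integrable mu (Iol l) f).

Lemma sqnormL2B_lt l (f g : R -> R) (e : R) : (L2dist2 l f g < e%:E)%E -> sqnorm l (f \- g) < e.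
Proof.
move=> fge; have dist0 : (0 <= L2dist2 l f g)%E.
  by apply: integral_ge0 => x _; rewrite lee_fin sqr_ge0.
rewrite -lte_fin /sqnormL2 /Rintegral fineK// ge0_fin_numE//.
by apply: lt_le_trans fge _; rewrite leey.
Qed.

Definition slope (u : R -> R -> R) (s t : R) : R -> R := fun x => (u s x - u t x) / (s - t).

Lemma slopeE u s t : slope u s t = (fun x => (s - t)^-1 * (u s \- u t) x).
Proof. by apply/funext => x; rewrite /slope mulrC. Qed.

Section along_filter.
Variables (l T t : R) (u : R -> R -> R) (v : R -> R).
Hypothesis uL2 : forall s : R, 0 < s -> s <= T -> L2 l (u s).
Hypotheses (t0 : 0 < t) (tT : t <= T) (uv : time_deriv l T u t v).
Context {I : Type} {F : set_system I} {FF : Filter F}.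
Variable tau : I -> R.
Hypotheses (tau_cvg : tau i @[i --> F] --> t) (tau_neq : \forall i \near F, tau i != t).
Hypothesis (tau_range : \forall i \near F, 0 < tau i <= T).

Lemma time_deriv_cvgL2 : cvgL2 mu (Iol l) (F := F) (fun i => slope u (tau i) t) v.
Proof.
split.
  apply: filterS tau_range => i /andP[i0 iT]; rewrite slopeE.
  by apply: sqr_integrableZ => //; apply: sqr_integrableB => //; exact: uL2.
apply/cvgrPdist_lt => e e0; have [vL /(_ e e0)[d d0 uvd]] := uv.
near=> i; rewrite sub0r normrN ger0_norm ?sqnormL2_ge0//; apply: sqnormL2B_lt.
have := uvd (tau i - t); rewrite subrKC; apply.
- by rewrite subr_eq0; near: i.
- by near: i; apply: cvgr_distC_lt tau_cvg _ d0.
- by have /andP[] : 0 < tau i <= T by near: i.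
- by have /andP[] : 0 < tau i <= T by near: i.
Unshelve. all: by end_near. Qed.

Lemma time_deriv_continuous : cvgL2 mu (Iol l) (F := F) (u \o tau) (u t).
Proof.
have vL : L2 l v by case: uv.
have [qL _] := time_deriv_cvgL2.
have q_cvg : sqnorm l (slope u (tau i) t) @[i --> F] --> sqnorm l v.
  exact: (cvgL2_sqnormL2 (measurable_Iol l) vL time_deriv_cvgL2).
split; first by apply: filterS tau_range => i /andP[]; exact: uL2.
have : (tau i - t) ^+ 2 * sqnorm l (slope u (tau i) t) @[i --> F] --> (t - t) ^+ 2 * sqnorm l v.
  by apply: cvgM => //; apply: cvgM; (apply: cvgB => //; exact: cvg_cst).
rewrite subrr expr0n mul0r; apply: cvg_trans; apply: near_eq_cvg; near=> i.
have it : tau i - t != 0 by rewrite subr_eq0; near: i.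
rewrite -sqnormL2Z//; last by near: i.
by apply: eq_Rintegral => x _ /=; rewrite /slope mulrC divfK.
Unshelve. all: by end_near. Qed.

End along_filter.

Lemma time_deriv_uniq l T t (u : R -> R -> R) v w : 0 < t -> t <= T ->
  (forall s : R, 0 < s -> s <= T -> L2 l (u s)) ->
  time_deriv l T u t v -> time_deriv l T u t w -> ae_eq_on l v w.
Proof.
move=> t0 tT uL2 uv uw; have [[vL _] [wL _]] := (uv, uw).
have left_cvg : s @[s --> t^'-] --> t by exact: cvg_at_left_filter.
have left_neq : \forall s \near t^'-, s != t.
  by near=> s; rewrite lt_eqF//; near: s; exact: nbhs_left_lt.
have left_range : \forall s \near t^'-, 0 < s <= T.
  near=> s; apply/andP; split; first by near: s; exact: nbhs_left_gt.
  by apply: le_trans tT; near: s; exact: nbhs_left_le.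
have slope_cvg v' : time_deriv l T u t v' -> cvgL2 mu (Iol l) (F := t^'-) (slope u ^~ t) v'.
  by move=> uv'; exact: (time_deriv_cvgL2 uL2 t0 tT uv').
exact: (cvgL2_unique (measurable_Iol l) vL wL (slope_cvg _ uv) (slope_cvg _ uw)).
Unshelve. all: by end_near. Qed.

End time_derivatives.

Section backward_uniqueness.
Context {R : realType}.
Local Notation mu := (@lebesgue_measure R).
Local Notation dot l f g := (dotL2 mu (Iol l) f g).
Local Notation sqnorm l f := (sqnormL2 mu (Iol l) f).
Local Notation L2 l f := (sqr_integrable mu (Iol l) f).
Variables (l T a : R) (u0 : R -> R) (u : R -> R -> R).
Hypotheses (l0 : 0 < l) (l1 : l <= 1) (sol : is_solution l T a u0 u).

Lemma solution_L2 t : 0 < t -> t <= T -> L2 l (u t).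
Proof. by move=> t0 tT; have [w [[[uL _] _] _]] := sol.1 t t0 tT. Qed.

Lemma solution_A_op t v : 0 < t -> t <= T -> time_deriv l T u t v ->
  exists2 w, A_op l a (u t) w & ae_eq_on l v w.
Proof.
move=> t0 tT uv; have [w [Aw uw]] := sol.1 t t0 tT.
by exists w => //; exact: (time_deriv_uniq t0 tT solution_L2 uv uw).
Qed.

Lemma solution_initial_cvg {I : Type} {F : set_system I} {FF : Filter F} (tau : I -> R) :
  tau i @[i --> F] --> 0 -> (\forall i \near F, 0 < tau i <= T) ->
  cvgL2 mu (Iol l) (F := F) (u \o tau) u0.
Proof.
move=> tau0 tauT; split; first by apply: filterS tauT => i /andP[]; exact: solution_L2.
apply/cvgrPdist_lt => e e0; have [d d0 ud] := sol.2 e e0.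
near=> i; rewrite sub0r normrN ger0_norm ?sqnormL2_ge0//; apply: sqnormL2B_lt.
have /andP[i0 iT] : 0 < tau i <= T by near: i.
apply: ud => //; rewrite -(gtr0_norm i0) -[tau i]subr0.
by near: i; apply: cvgr_distC_lt tau0 _ d0.
Unshelve. all: by end_near. Qed.

Definition pairing c t : R := dot l (u t) (u (c - t)).

Lemma pairing_slope c s t : 0 < s <= T -> 0 < t <= T -> 0 < c - s <= T -> 0 < c - t <= T ->
  (s - t)^-1 * (pairing c s - pairing c t) =
  dot l (slope u s t) (u (c - s)) - dot l (u t) (slope u (c - s) (c - t)).
Proof.
move=> /andP[s0 sT] /andP[t0 tT] /andP[cs0 csT] /andP[ct0 ctT].
have [usL utL] := (solution_L2 s0 sT, solution_L2 t0 tT).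
have [ucsL uctL] := (solution_L2 cs0 csT, solution_L2 ct0 ctT).
have mI := measurable_Iol l.
have slope_l : dot l (slope u s t) (u (c - s)) =
    (s - t)^-1 * (dot l (u s) (u (c - s)) - dot l (u t) (u (c - s))).
  by rewrite slopeE dotL2Zl ?dotL2Bl//; exact: sqr_integrableB.
have slope_r : dot l (u t) (slope u (c - s) (c - t)) =
    (s - t)^-1 * (dot l (u t) (u (c - t)) - dot l (u t) (u (c - s))).
  rewrite dotL2C slopeE dotL2Zl ?dotL2Bl//; last exact: sqr_integrableB.
  rewrite !(dotL2C mu (Iol l) _ (u t)).
  by rewrite (_ : c - s - (c - t) = - (s - t)) ?invrN; ring.
by rewrite slope_l slope_r /pairing; ring.
Qed.

Section along_filter.
Context {I : Type} {F : set_system I} {FF : Filter F}.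
Variables (c t : R) (tau : I -> R).
Hypotheses (t_range : 0 < t <= T) (ct_range : 0 < c - t <= T).
Hypotheses (tau_cvg : tau i @[i --> F] --> t) (tau_neq : \forall i \near F, tau i != t).
Hypothesis (tau_range : \forall i \near F, 0 < tau i <= T).
Hypothesis (ctau_range : \forall i \near F, 0 < c - tau i <= T).

(* The limit is [<A u(t), u(c - t)> - <u(t), A u(c - t)>], and the operator is symmetric. *)
Lemma pairing_slope_cvg0 :
  (tau i - t)^-1 * (pairing c (tau i) - pairing c t) @[i --> F] --> 0.
Proof.
have [[t0 tT] [ct0 ctT]] := (andP t_range, andP ct_range).
have [w [Aw uw]] := sol.1 t t0 tT; have [z [Az uz]] := sol.1 (c - t) ct0 ctT.
have [wL zL] : L2 l w /\ L2 l z by case: uw; case: uz.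
have ctau_cvg : c - tau i @[i --> F] --> c - t by apply: cvgB => //; exact: cvg_cst.
have ctau_neq : \forall i \near F, c - tau i != c - t.
  by apply: filterS tau_neq => i ?; rewrite (inj_eq (addrI _)) eqr_opp.
have slope1 : cvgL2 mu (Iol l) (F := F) (fun i => slope u (tau i) t) w.
  exact: (time_deriv_cvgL2 solution_L2 t0 tT uw).
have slope2 : cvgL2 mu (Iol l) (F := F) (fun i => slope u (c - tau i) (c - t)) z.
  exact: (time_deriv_cvgL2 solution_L2 ct0 ctT uz).
have u_cvg : cvgL2 mu (Iol l) (F := F) (fun i => u (c - tau i)) (u (c - t)).
  exact: (time_deriv_continuous solution_L2 ct0 ctT uz).
have [utL uctL] := (solution_L2 t0 tT, solution_L2 ct0 ctT).
have ut_cvg : cvgL2 mu (Iol l) (F := F) (fun=> u t) (u t) by exact: cvgL2_cst.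
have : dot l (slope u (tau i) t) (u (c - tau i)) - dot l (u t) (slope u (c - tau i) (c - t))
    @[i --> F] --> dot l w (u (c - t)) - dot l (u t) z.
  by apply: cvgB; exact: cvgL2_dotL2.
rewrite (A_op_symmetric l0 l1 Aw Az) subrr; apply: cvg_trans; apply: near_eq_cvg.
by apply: filterS2 tau_range ctau_range => i ? ?; rewrite pairing_slope.
Qed.

Lemma pairing_cvg : pairing c (tau i) @[i --> F] --> pairing c t.
Proof.
have : (tau i - t) * ((tau i - t)^-1 * (pairing c (tau i) - pairing c t)) + pairing c t
    @[i --> F] --> (t - t) * 0 + pairing c t.
  apply: cvgD; last exact: cvg_cst.
  by apply: cvgM; [apply: cvgB => //; exact: cvg_cst|exact: pairing_slope_cvg0].
rewrite mulr0 add0r; apply: cvg_trans; apply: near_eq_cvg.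
by apply: filterS tau_neq => i ti; rewrite mulVKf ?subr_eq0// subrK.
Qed.

End along_filter.

Lemma is_derive_pairing c t : 0 < t < T -> 0 < c - t < T -> is_derive t 1 (pairing c) 0.
Proof.
move=> /andP[t0 tT] /andP[ct0 ctT].
suff slope_cvg : h^-1 *: (pairing c (h *: 1 + t) - pairing c t) @[h --> (0 : R)^'] --> (0 : R).
  by apply: DeriveDef; [apply/cvg_ex; exists 0|exact/cvg_lim].
have th_cvg : h *: 1 + t @[h --> (0 : R)^'] --> t.
  rewrite -[X in _ --> X]add0r; apply: cvgD; last exact: cvg_cst.
  by under eq_fun do rewrite /GRing.scale/= mulr1; exact: cvg_within.
have cth_cvg : c - (h *: 1 + t) @[h --> (0 : R)^'] --> c - t.
  by apply: cvgB => //; exact: cvg_cst.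
rewrite (_ : (fun h => _) = fun h =>
    (h *: 1 + t - t)^-1 * (pairing c (h *: 1 + t) - pairing c t)); last first.
  by apply/funext => h; rewrite addrK /GRing.scale/= mulr1.
apply: pairing_slope_cvg0 => //.
- by rewrite t0 ltW.
- by rewrite ct0 ltW.
- near=> h; rewrite -subr_eq0 addrK /GRing.scale/= mulr1.
  by near: h; exact: nbhs_dnbhs_neq.
- by near=> h; apply/andP; split; near: h; [exact: cvgr_gt th_cvg _ t0|exact: cvgr_le th_cvg _ tT].
- by near=> h; apply/andP; split; near: h;
    [exact: cvgr_gt cth_cvg _ ct0|exact: cvgr_le cth_cvg _ ctT].
Unshelve. all: by end_near. Qed.

Lemma pairing_cst c s t : 0 < s -> s < t -> t <= T -> 0 < c - t -> c - s < T ->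
  pairing c s = pairing c t.
Proof.
move=> s0 st tT ct0 csT; apply/esym/eqP; rewrite -subr_eq0; apply/eqP.
have dpairing x : x \in `]s, t[ -> is_derive x 1 (pairing c) 0.
  rewrite in_itv/= => /andP[sx xt]; apply: is_derive_pairing.
    by rewrite (lt_trans s0 sx) (lt_le_trans xt tT).
  by apply/andP; split; lra.
have [|y _ ->] := @MVT _ _ (fun=> 0) _ _ st dpairing; last by rewrite mul0r.
apply/(continuous_within_itvP _ st); split.
- by move=> x /dpairing dx; apply/differentiable_continuous/derivable1_diffP; case: dx.
- apply: pairing_cvg.
  + by rewrite s0 ltW// (lt_le_trans st).
  + by apply/andP; split; lra.
  + exact: cvg_at_right_filter.
  + by near=> x; rewrite gt_eqF.
  + near=> x; rewrite (lt_trans s0)//=.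
    by near: x; apply: nbhs_right_ltW; exact: lt_le_trans tT.
  + near=> x; apply/andP; split; last by rewrite (le_trans _ (ltW csT))// lerD2l lerN2 ltW.
    by rewrite subr_gt0; near: x; apply: nbhs_right_lt; lra.
- apply: pairing_cvg.
  + by rewrite (lt_trans s0 st).
  + by apply/andP; split; lra.
  + exact: cvg_at_left_filter.
  + by near=> x; rewrite lt_eqF.
  + near=> x; apply/andP; split; last exact: le_trans tT.
    by near: x; apply: nbhs_left_gt; lra.
  + near=> x; apply/andP; split; first by rewrite (lt_le_trans ct0)// lerD2l lerN2.
    by rewrite (le_trans _ (ltW csT))// lerD2l lerN2 ltW//; near: x; exact: nbhs_left_gt.
Unshelve. all: by end_near. Qed.

Lemma solution_midpoint r s : 0 < r -> r < s -> s <= T ->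
  sqnorm l (u ((r + s) / 2)) = dot l (u s) (u r).
Proof.
move=> r0 rs sT; rewrite -dotL2_sqnorm.
have -> : dot l (u s) (u r) = pairing (r + s) s by rewrite /pairing addrK.
rewrite -(@pairing_cst _ ((r + s) / 2)); [|lra..].
by rewrite /pairing; congr dotL2; congr u; field.
Qed.

Lemma solution_backward_zero t : 0 < t -> t <= T -> sqnorm l (u t) = 0 ->
  sqnorm l (u (3 / 4 * t)) = 0.
Proof.
move=> t0 tT ut0; have [t20 t2t t2T] : [/\ 0 < t / 2, t / 2 < t & t / 2 <= T] by split; lra.
have -> : 3 / 4 * t = (t / 2 + t) / 2 by field.
rewrite solution_midpoint//; apply/eqP; rewrite -normr_le0.
have := normr_dotL2_le (measurable_Iol l) (solution_L2 t0 tT) (solution_L2 t20 t2T).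
by rewrite ut0 sqrtr0 mul0r.
Qed.

Lemma solution_backward_unique t : isL2 l u0 -> 0 < t -> t <= T ->
  ae_eq_on l (u t) (cst 0) -> ae_eq_on l u0 (cst 0).
Proof.
rewrite isL2E => u0L t0 tT ut0; pose tau (n : nat) : R := (3 / 4) ^+ n * t.
have tau_range n : 0 < tau n <= T.
  rewrite mulr_gt0 ?exprn_gt0//=.
  by apply: le_trans tT; rewrite ler_piMl ?(ltW t0)// exprn_ile1//; lra.
have utau0 n : sqnorm l (u (tau n)) = 0.
  elim: n => [|n IHn]; last first.
    by rewrite /tau exprS -mulrA; have /andP[? ?] := tau_range n; exact: solution_backward_zero.
  rewrite /tau expr0 mul1r; apply: sqnormL2_ae0 => //.
  by have [] := solution_L2 t0 tT.
have tau0 : tau n @[n --> \oo] --> 0.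
  rewrite -(mul0r t); apply: cvgM; last exact: cvg_cst.
  by apply: cvg_expr; rewrite ger0_norm//; lra.
have cst0L : L2 l (cst 0).
  exact: (sqr_integrable_cst (measurable_Iol l) _ (lebesgue_measure_Iol_lty l)).
have cvg_u0 : cvgL2 mu (Iol l) (F := \oo) (u \o tau) u0.
  exact: (solution_initial_cvg tau0 (nearW _ tau_range)).
have cvg_0 : cvgL2 mu (Iol l) (F := \oo) (u \o tau) (cst 0).
  split; first by apply: nearW => n; have /andP[] := tau_range n; exact: solution_L2.
  rewrite (_ : (fun n => _) = cst 0); first exact: cvg_cst.
  apply/funext => n; rewrite -[RHS](utau0 n).
  by apply: eq_Rintegral => x _ /=; rewrite subr0.
exact: (cvgL2_unique (measurable_Iol l) u0L cst0L cvg_u0 cvg_0).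
Qed.

End backward_uniqueness.

Theorem theorem3p5 (R : realType) (l T : R) (u0 : R -> R) (a1 a2 : R)
  (u1 u2 : R -> R -> R) (t0 : R) (v1 v2 g1 g2 : R -> R) :
  0 < l -> l <= 1 -> 0 < T ->
  isL2 l u0 -> ~ ae_eq_on l u0 (fun _ => 0) ->
  0 <= a1 -> a1 < 2 -> 0 <= a2 -> a2 < 2 ->
  is_solution l T a1 u0 u1 -> is_solution l T a2 u0 u2 ->
  0 < t0 -> t0 <= T ->
  time_deriv l T u1 t0 v1 -> time_deriv l T u2 t0 v2 -> ae_eq_on l v1 v2 ->
  weak_deriv l (u1 t0) g1 -> weak_deriv l (u2 t0) g2 -> ae_eq_on l g1 g2 ->
  a1 = a2.
Proof.
move=> l0 l1 _ u0L u0_neq0 _ _ _ _ sol1 sol2 t0_gt0 t0T uv1 uv2 v12 ug1 ug2 g12.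
have [w1 A1 vw1] := solution_A_op sol1 t0_gt0 t0T uv1.
have [w2 A2 vw2] := solution_A_op sol2 t0_gt0 t0T uv2.
have w12 : ae_eq_on l w1 w2 by exact: ae_eq_trans (ae_eq_trans (ae_eq_sym vw1) v12) vw2.
have [a12|a21|//] := ltgtP a1 a2; case: u0_neq0.
- apply: (solution_backward_unique l0 l1 sol1 u0L t0_gt0 t0T).
  exact: (A_op_same_derivatives_eq0 l0 l1 a12 A1 A2 w12 ug1 ug2 g12).
- apply: (solution_backward_unique l0 l1 sol2 u0L t0_gt0 t0T).
  exact: (A_op_same_derivatives_eq0 l0 l1 a21 A2 A1 (ae_eq_sym w12) ug2 ug1 (ae_eq_sym g12)).
Qed.
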